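(* Let $\beta\in\mathbb{R}\setminus\{0\}$ and let $X^\beta$ be the vector field on $\mathbb{R}^3$ given by $X^\beta(x,y,z)=(yz+\beta y)\partial_x+(xz-\beta x)\partial_y-xy\,\partial_z$. Let $M\in\mathbb{R}$ and $\Sigma^\beta_{-\beta M}:=\{(x,y,z)\in\mathbb{R}^3:\tfrac14(-x^2+y^2)-\beta z=-\beta M\}$, which contains the equilibrium $(0,0,M)$ and to which $X^\beta$ is tangent. Then: (a) the characteristic polynomial of the linearization of $X^\beta|_{\Sigma^\beta_{-\beta M}}$ at $(0,0,M)$ is $\mu^2+(\beta^2-M^2)$; (b) if $|\beta|<|M|$, $(0,0,M)$ is an unstable equilibrium of $X^\beta|_{\Sigma^\beta_{-\beta M}}$; (c) if $|\beta|>|M|$, $(0,0,M)$ is a Lyapunov stable equilibrium of $X^\beta|_{\Sigma^\beta_{-\beta M}}$; (d) if $|\beta|>|M|$, there exist $\widetilde{\varepsilon_0}>0$ and a one-parameter family $\{\widetilde{\gamma_\varepsilon}\}_{0<\varepsilon\le\widetilde{\varepsilon_0}}\subset\Sigma^\beta_{-\beta M}$ of periodic orbits of $X^\beta|_{\Sigma^\beta_{-\beta M}}$ (hence of $X^\beta$) shrinking to $(0,0,M)$ as $\varepsilon\to0$, with periods $T_\varepsilon\to2\pi/\sqrt{\beta^2-M^2}$ as $\varepsilon\to0$; moreover $\{(0,0,M)\}\cup\bigcup_{0<\varepsilon<\widetilde{\varepsilon_0}}\widetilde{\gamma_\varepsilon}$ is the connected component of $\Sigma^\beta_{-\beta M}\setminus\widetilde{\gamma_{\widetilde{\varepsilon_0}}}$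 containing $(0,0,M)$.
   Context: The linearization of a vector field $Y$ at an equilibrium $m$ (here of the restricted field on the surface $\Sigma^\beta_{-\beta M}$) is the linear endomorphism $v\mapsto\frac{\mathrm{d}}{\mathrm{d}t}(\mathrm{D}F^Y_t(m)v)|_{t=0}$ of the tangent space at $m$, $F^Y_t$ the flow. *)

(* Defs.v *)
From HB Require Import structures.
From mathcomp Require Import all_boot all_order all_algebra.
From mathcomp Require Import all_classical all_reals all_analysis.
Set Implicit Arguments. Unset Strict Implicit. Unset Printing Implicit Defensive.
Import Order.TTheory GRing.Theory Num.Theory.
Import numFieldNormedType.Exports.
Local Open Scope classical_set_scope.
Local Open Scope ring_scope.

Section Defs.
Variable R : realType.

Definition pt (x y z : R) : 'rV[R]_3 := \row_(i < 3) [:: x; y; z]`_i.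

Definition cx (p : 'rV[R]_3) : R := p ord0 ord0.
Definition cy (p : 'rV[R]_3) : R := p ord0 (lift ord0 ord0).
Definition cz (p : 'rV[R]_3) : R := p ord0 ord_max.

Definition Xb (beta : R) (p : 'rV[R]_3) : 'rV[R]_3 :=
  pt (cy p * cz p + beta * cy p) (cx p * cz p - beta * cx p) (- (cx p * cy p)).

Definition Gb (beta : R) (p : 'rV[R]_3) : R :=
  4^-1 * (- cx p ^+ 2 + cy p ^+ 2) - beta * cz p.

Definition Sigma (beta c : R) : set 'rV[R]_3 := [set p | Gb beta p = c].

(* tangent space at m of the regular level set {G = c}: kernel of dG(m) *)
Definition tangent_space (G : 'rV[R]_3 -> R) (m : 'rV[R]_3) : set 'rV[R]_3 :=
  [set v | 'D_v G m = 0].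

Definition is_flow (X : 'rV[R]_3 -> 'rV[R]_3) (F : R -> 'rV[R]_3 -> 'rV[R]_3) : Prop :=
  forall p, F 0 p = p /\ forall t : R, is_derive t (1 : R) (fun s : R => F s p) (X (F t p)).

Definition linearization (F : R -> 'rV[R]_3 -> 'rV[R]_3) (m : 'rV[R]_3)
  (v : 'rV[R]_3) : 'rV[R]_3 :=
  'D_(1 : R) (fun t : R => 'D_v (F t) m) (0 : R).

Definition is_basis2 (S : set 'rV[R]_3) (e : 'I_2 -> 'rV[R]_3) : Prop :=
  [/\ forall j, S (e j),
      (forall c : 'I_2 -> R, \sum_(j < 2) c j *: e j = 0 -> forall j, c j = 0) &
      (forall v, S v -> exists c : 'I_2 -> R, v = \sum_(j < 2) c j *: e j)].

Definition represents (L : 'rV[R]_3 -> 'rV[R]_3) (e : 'I_2 -> 'rV[R]_3)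
  (A : 'M[R]_2) : Prop :=
  forall j : 'I_2, L (e j) = \sum_(i < 2) A i j *: e i.

Definition lyapunov_stable (F : R -> 'rV[R]_3 -> 'rV[R]_3) (S : set 'rV[R]_3)
  (m : 'rV[R]_3) : Prop :=
  forall eps : R, 0 < eps -> exists2 delta : R, 0 < delta &
    forall p, S p -> `|p - m| < delta -> forall t : R, 0 <= t -> `|F t p - m| < eps.

Definition unstable F S m : Prop := ~ lyapunov_stable F S m.

Definition flow_orbit (F : R -> 'rV[R]_3 -> 'rV[R]_3) (p : 'rV[R]_3) : set 'rV[R]_3 :=
  [set F t p | t in [set: R]].

Definition periodic_point (F : R -> 'rV[R]_3 -> 'rV[R]_3) (p : 'rV[R]_3) (T : R) : Prop :=
  [/\ 0 < T, F T p = p & forall t, 0 < t -> t < T -> F t p != p].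

End Defs.

(* Main.v *)
(* Besides [G = (y^2 - x^2) / 4 - beta z], the field preserves
   [x^2 + (z + beta)^2] and [y^2 + (z - beta)^2], so on [Sigma] it preserves
   [V = (1 - M / beta) / 2 * x^2 + (1 + M / beta) / 2 * y^2 + (z - M)^2].

   (a) By Gronwall, [F t (m + h v)] is [m + h W t + O(h^2)], where [W] is the
   explicit solution of the system linearised at [m].

   (b) If [|beta| < |M|], then [z + beta] and [z - beta] have the sign of [M] near
   [m], so [sg M * x * y] grows without bound along an orbit staying near [m].

   (c), (d) If [|M| < |beta|], then [V] is positive definite, and each level [V = e]
   is a single periodic orbit: for [beta > 0], with
   [A^2 = x^2 + (z + beta)^2] and [B^2 = y^2 + (z - beta)^2], the functions
   [u = x / sqrt (A + beta + z)] and [v = y / sqrt (B + beta - z)] satisfy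
   [u^2 + v^2 = A + B - 2 beta], [u' = w v], [v' = - w u] with
   [w = sqrt ((A + beta + z) (B + beta - z)) / 2]. Bounding [w] above and below
   squeezes the period. The case [beta < 0] follows by exchanging [x] and [y]. *)
Require Import Defs.
From HB Require Import structures.
From mathcomp Require Import all_boot all_order all_algebra.
From mathcomp Require Import all_classical all_reals all_analysis.
From mathcomp Require Import ring lra.
Set Implicit Arguments. Unset Strict Implicit. Unset Printing Implicit Defensive.
Import Order.TTheory GRing.Theory Num.Theory.
Import numFieldNormedType.Exports.
Local Open Scope classical_set_scope.
Local Open Scope ring_scope.

(** * Differential calculus on the real line: monotonicity, Gronwall, antiderivatives *)

Section PointwiseDerivatives.
Context {R : realType}.
Implicit Types (f g : R -> R) (t a b c : R).

Lemma is_derive_addf f g t a b : is_derive t 1 f a -> is_derive t 1 g b ->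
  is_derive t 1 (fun s => f s + g s) (a + b).
Proof. by move=> fa gb; apply: is_deriveD. Qed.

Lemma is_derive_oppf f t a : is_derive t 1 f a ->
  is_derive t 1 (fun s => - f s) (- a).
Proof. by move=> fa; apply: is_deriveN. Qed.

Lemma is_derive_mulf f g t a b : is_derive t 1 f a -> is_derive t 1 g b ->
  is_derive t 1 (fun s => f s * g s) (a * g t + f t * b).
Proof.
move=> fa gb; have := is_deriveM fa gb.
by rewrite /GRing.scale/= [g t * a]mulrC addrC.
Qed.

Lemma is_derive_expf f n t a : is_derive t 1 f a ->
  is_derive t 1 (fun s => f s ^+ n.+1) (n.+1%:R * f t ^+ n * a).
Proof.
move=> fa; have := @is_deriveX _ _ f n.+1 t 1 a fa.
by rewrite exprfctE.
Qed.

Lemma is_derive_sqrtf f t a : 0 < f t -> is_derive t 1 f a ->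
  is_derive t 1 (fun s => Num.sqrt (f s)) (a / (2 * Num.sqrt (f t))).
Proof.
move=> f0 fa; have := is_derive1_sqrt f0 => dsq.
by have := @is_derive1_comp R Num.sqrt f t _ _ dsq fa; rewrite [_ * a]mulrC.
Qed.

Lemma is_derive_invf f t a : f t != 0 -> is_derive t 1 f a ->
  is_derive t 1 (fun s => (f s)^-1) (- a / f t ^+ 2).
Proof.
move=> f0 fa; have := @is_deriveV R f t a 1 f0 fa.
by rewrite /GRing.scale/= => H; apply: is_derive_eq H _; field.
Qed.

Lemma is_derive_cstf c t : is_derive t 1 (fun=> c) 0.
Proof. exact: is_derive_cst. Qed.

Lemma is_derive_compf f g t a b : is_derive (g t) 1 f a -> is_derive t 1 g b ->
  is_derive t 1 (fun s => f (g s)) (a * b).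
Proof. exact: is_derive1_comp. Qed.

Lemma is_derive_continuous f t a : is_derive t 1 f a -> {for t, continuous f}.
Proof.
by move=> fa; apply/differentiable_continuous/derivable1_diffP/ex_derive.
Qed.

Lemma is_derive_continuous_within f df a b :
  (forall t, a <= t <= b -> is_derive t 1 f (df t)) ->
  {within `[a, b], continuous f}.
Proof.
move=> H; apply/continuous_in_subspaceT => t /[!inE]/= /[!in_itv]/= tab.
exact/is_derive_continuous/H.
Qed.

Lemma is_derive_le_nonincreasing f df a b : a <= b ->
  (forall t, a <= t <= b -> is_derive t 1 f (df t)) ->
  (forall t, a <= t <= b -> df t <= 0) -> f b <= f a.
Proof.
move=> ab fd d0.
have [t||c] := @MVT_segment R f df a b ab.
- by rewrite in_itv/= => /andP[at1 tb]; apply: fd; rewrite !ltW.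
- exact: is_derive_continuous_within fd.
rewrite in_itv/= => cab E; rewrite -subr_le0 E.
by rewrite mulr_le0_ge0 ?d0 ?subr_ge0.
Qed.

Lemma is_derive_ge_nondecreasing f df a b : a <= b ->
  (forall t, a <= t <= b -> is_derive t 1 f (df t)) ->
  (forall t, a <= t <= b -> 0 <= df t) -> f a <= f b.
Proof.
move=> ab fd d0; rewrite -lerN2.
apply: (@is_derive_le_nonincreasing (fun t => - f t) (fun t => - df t)) => // t tab.
  exact/is_derive_oppf/fd.
by rewrite oppr_le0 d0.
Qed.

Lemma is_derive0_eq f a b : a <= b ->
  (forall t, a <= t <= b -> is_derive t 1 f 0) -> f a = f b.
Proof.
move=> ab fd; apply/eqP; rewrite eq_le.
rewrite (is_derive_ge_nondecreasing ab fd) //.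
by rewrite (is_derive_le_nonincreasing ab fd).
Qed.

(** With the integrating factor, [(f t + c) * expR (- K * t)] has derivative
    [(df t - K * (f t + c)) * expR (- K * t)], which is nonpositive. *)
Lemma gronwall_forward f df K c T : 
  (forall t, is_derive t 1 f (df t)) ->
  (forall t, 0 <= t <= T -> `|df t| <= K * (f t + c)) -> 
  forall t, 0 <= t <= T -> f t + c <= (f 0 + c) * expR (K * t).
Proof.
move=> fd dfK t /andP[t0 tT].
have := @is_derive_le_nonincreasing (fun s => (f s + c) * expR (- K * s))
  (fun s => (df s - K * (f s + c)) * expR (- K * s)) 0 t t0.
rewrite mulr0 expR0 mulr1 mulNr expRN ler_pdivrMr ?expR_gt0//.
apply.
- move=> s _.
  have ds : is_derive s 1 (fun s => expR (- K * s)) (expR (- K * s) * (- K)).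
    apply: is_derive_compf.
    have := is_derive_mulf (is_derive_cstf (- K) s) (is_derive_id s 1).
    by rewrite mul0r add0r mulr1.
  apply: is_derive_eq (is_derive_mulf (is_derive_addf (fd s) (is_derive_cstf c s)) ds) _.
  ring.
- move=> s /andP[s0 st]; rewrite mulr_le0_ge0 ?expR_ge0// subr_le0.
  by rewrite (le_trans (ler_norm _))// dfK// s0 (le_trans st).
Qed.

(** Negative times reduce to positive ones by applying the forward version to [fun s => f (- s)]. *)
Lemma gronwall f df K c T : 0 <= K -> 0 <= f 0 + c ->
  (forall t, is_derive t 1 f (df t)) ->
  (forall t, `|t| <= T -> `|df t| <= K * (f t + c)) -> 
  forall t, `|t| <= T -> f t + c <= (f 0 + c) * expR (K * T).
Proof.
move=> K0 fc fd dfK t tT.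
apply: (@le_trans _ _ ((f 0 + c) * expR (K * `|t|))); last first.
  by rewrite ler_wpM2l// ler_expR ler_wpM2l.
have [t0|t0] := leP 0 t.
  rewrite ger0_norm//; apply: (@gronwall_forward f df K c `|t|) => //.
    move=> s /andP[s0 st]; apply: dfK; rewrite ger0_norm//.
    exact: le_trans tT.
  by rewrite t0 ler_norm.
rewrite ltr0_norm//.
have := @gronwall_forward (fun s => f (- s)) (fun s => - df (- s)) K c `|t|.
rewrite oppr0 => /(_ _ _ (- t)); rewrite opprK; apply.
- move=> s; have dN : is_derive s 1 (fun s : R => - s) (-1).
    exact: is_derive_oppf (is_derive_id s 1).
  by apply: is_derive_eq (is_derive_compf (fd _) dN) _; rewrite mulrN1.
- move=> s /andP[s0 st]; rewrite normrN; apply: dfK.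
  by rewrite normrN ger0_norm// (le_trans st).
- by rewrite ltr0_norm// lexx oppr_ge0 ltW.
Qed.

(* [-1] only serves to have differentiability at the left endpoint [0]. *)
Lemma continuous_antiderivative f b : continuous f -> 
  exists2 g, g 0 = 0 & forall t, 0 <= t < b -> is_derive t 1 g (f t).
Proof.
move=> cf.
pose G x : R := (\int[@lebesgue_measure R]_(t in [set` `[-1, x]]) f t)%R.
exists (fun t => G t - G 0); first by rewrite subrr.
move=> t /andP[t0 tb].
have [|||dG GE] := @continuous_FTC1_closed R f (-1) t b tb.
- apply: continuous_compact_integrable; first exact: segment_compact.
  exact: continuous_subspaceT.
- by rewrite (lt_le_trans _ t0)// ltrN10.
- exact: cf.
apply: is_derive_eq (is_derive_addf _ (is_derive_oppf (is_derive_cstf (G 0) t))) _.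
  exact: derivableP dG.
by rewrite oppr0 addr0 -derive1E.
Qed.

End PointwiseDerivatives.

(** * Coordinates, norm and derivatives in three-dimensional space *)

Section Coordinates.
Context {R : realType}.
Implicit Types (p q v w : 'rV[R]_3) (x y z : R).

Lemma cx_pt x y z : cx (pt x y z) = x. Proof. by rewrite /cx mxE. Qed.
Lemma cy_pt x y z : cy (pt x y z) = y. Proof. by rewrite /cy mxE. Qed.
Lemma cz_pt x y z : cz (pt x y z) = z. Proof. by rewrite /cz mxE. Qed.
Definition coord_pt := (cx_pt, cy_pt, cz_pt).

Lemma rV3_ind (P : 'I_3 -> Prop) :
  P ord0 -> P (lift ord0 ord0) -> P ord_max -> forall i, P i.
Proof.
move=> P0 P1 P2 [[|[|[|//]]] i3].
- by rewrite (_ : Ordinal _ = ord0) //; apply: val_inj.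
- by rewrite (_ : Ordinal _ = lift ord0 ord0) //; apply: val_inj.
- by rewrite (_ : Ordinal _ = ord_max) //; apply: val_inj.
Qed.

Lemma pt_eta p : p = pt (cx p) (cy p) (cz p).
Proof.
by apply/rowP; apply: rV3_ind; rewrite mxE.
Qed.

Lemma rV3P p q : cx p = cx q -> cy p = cy q -> cz p = cz q -> p = q.
Proof. by rewrite [p]pt_eta [q]pt_eta !coord_pt => -> -> ->. Qed.

Lemma coord_lin h v p :
  (cx (h *: v + p) = h * cx v + cx p) * (cy (h *: v + p) = h * cy v + cy p) *
  (cz (h *: v + p) = h * cz v + cz p).
Proof. by rewrite /cx /cy /cz !mxE. Qed.

Lemma coordB p q :
  (cx (p - q) = cx p - cx q) * (cy (p - q) = cy p - cy q) * (cz (p - q) = cz p - cz q).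
Proof. by rewrite /cx /cy /cz !mxE. Qed.

Lemma norm_rV3_lt p e :
  (`|p| < e) = [&& 0 < e, `|cx p| < e, `|cy p| < e & `|cz p| < e].
Proof.
rewrite /Num.Def.normr/= mx_normrE; apply/bigmax_ltP/and4P => /=.
  by move=> [e0 H]; split=> //; [exact: (H (ord0, ord0))|
    exact: (H (ord0, lift ord0 ord0))|exact: (H (ord0, ord_max))].
move=> [e0 px py pz]; split=> // -[i j] _ /=; rewrite (ord1 i).
by move: j; apply: rV3_ind.
Qed.

Lemma is_derive_rV3P (V : normedModType R) (f : V -> 'rV[R]_3) (t v : V) l :
  is_derive t v f l <-> [/\ is_derive t v (fun s => cx (f s)) (cx l),
    is_derive t v (fun s => cy (f s)) (cy l) &
    is_derive t v (fun s => cz (f s)) (cz l)].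
Proof.
have coordE i : derivable f t v -> 'D_v (fun s => f s ord0 i) t = ('D_v f t) ord0 i.
  by move=> fd; rewrite derive_mx// mxE.
split=> [[fd <-]|[[dx ex] [dy ey] [dz ez]]].
  have /derivable_mxP fd' := fd.
  by split; split; solve [exact: fd' | exact: coordE].
have fd : derivable f t v.
  by apply/derivable_mxP => i; rewrite (ord1 i); apply: rV3_ind.
split=> //; apply: rV3P.
- by rewrite -ex; exact/esym/coordE.
- by rewrite -ey; exact/esym/coordE.
- by rewrite -ez; exact/esym/coordE.
Qed.

(** After division by [h] the remainder is at most [C * |h|]. This turns explicit second-order
    estimates into directional derivatives; it serves to differentiate the flow with respect to its
    initial point. *)
Lemma is_derive_quadratic (V : normedModType R) (f : V -> R) (p v : V) l C :
  (forall h : R, `|h| <= 1 -> `|f (h *: v + p) - f p - h * l| <= C * h ^+ 2) ->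
  is_derive p v f l.
Proof.
move=> H.
have C0 : 0 <= C.
  by have := H 1; rewrite normr1 expr1n mulr1 => /(_ (lexx _)); apply: le_trans.
have cv : h^-1 *: (f (h *: v + p) - f p) @[h --> 0^'] --> (l : R).
  apply/cvgrPdist_lt => /= e e0.
  near=> h.
  have h0 : h != 0 by near: h; exact: nbhs_dnbhs_neq.
  have h1 : `|h| < 1.
    by near: h; apply: dnbhs0_lt.
  (* The denominator is [C + 1] because [C] may vanish. *)
  have hC : `|h| < e / (C + 1).
    by near: h; apply: dnbhs0_lt; rewrite divr_gt0// ltr_wpDl.
  rewrite distrC -(ltr_pM2l (_ : 0 < `|h|)) ?normr_gt0// -normrM.
  rewrite mulrBr {1}/GRing.scale/= mulVKf//.
  apply: (le_lt_trans (H h (ltW h1))).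
  rewrite -real_normK ?num_real// expr2 mulrCA ltr_pM2l ?normr_gt0//.
  apply: (@le_lt_trans _ _ ((C + 1) * `|h|)); first by rewrite ler_wpM2r// lerDl.
  by rewrite mulrC -ltr_pdivlMr// ltr_wpDl.
by split; [apply/cvg_ex; exists l|apply/cvg_lim].
Unshelve. all: by end_near. Qed.

End Coordinates.

(** * Integral curves in coordinates and their two conserved quantities *)

Section Integrals.
Context {R : realType}.
Implicit Types (b : R) (x y z : R -> R).

(** Stated for three separate real functions so that [x] and [y] can be exchanged. *)
Definition solution b x y z := forall t : R,
  [/\ is_derive t 1 x ((z t + b) * y t), is_derive t 1 y ((z t - b) * x t) &
      is_derive t 1 z (- (x t * y t))].

Lemma flow_solution b F p : is_flow (Xb b) F ->
  solution b (fun t => cx (F t p)) (fun t => cy (F t p)) (fun t => cz (F t p)).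
Proof.
move=> flowF t; have [_ /(_ t)] := flowF p; move/is_derive_rV3P.
rewrite !coord_pt => -[dx dy dz]; split=> //.
- by apply: is_derive_eq dx _; ring.
- by apply: is_derive_eq dy _; ring.
Qed.

(** This symmetry yields the second conserved quantity from the first, and the case [beta < 0] from
    the case [beta > 0]. *)
Lemma solution_swap b x y z : solution b x y z -> solution (- b) y x z.
Proof.
by move=> sol t; have [dx dy dz] := sol t; rewrite opprK [y t * _]mulrC.
Qed.

Lemma solution_integral b x y z t : solution b x y z ->
  x t ^+ 2 + (z t + b) ^+ 2 = x 0 ^+ 2 + (z 0 + b) ^+ 2.
Proof.
move=> sol.
apply: (@is_derive_0_is_cst R (fun t => x t ^+ 2 + (z t + b) ^+ 2)) => {}t.
have [dx dy dz] := sol t.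
apply: is_derive_eq (is_derive_addf (is_derive_expf 1 dx)
  (is_derive_expf 1 (is_derive_addf dz (is_derive_cstf b t)))) _.
ring.
Qed.

Lemma solution_integral' b x y z t : solution b x y z ->
  y t ^+ 2 + (z t - b) ^+ 2 = y 0 ^+ 2 + (z 0 - b) ^+ 2.
Proof. by move=> /solution_swap; exact: solution_integral. Qed.

End Integrals.

(** * Planar rotation with variable angular velocity *)

Section Rotation.
Context {R : realType}.
Implicit Types (A B b : R).

Lemma unit_circle_angle (u v : R) : u ^+ 2 + v ^+ 2 = 1 ->
  exists2 th, 0 <= th <= 2 * pi & u = cos th /\ v = sin th.
Proof.
move=> uv1.
have u1 : -1 <= u <= 1.
  by rewrite -ler_norml -(@expr_le1 _ 2)// real_normK ?num_real// -uv1 lerDl sqr_ge0.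
have v2 : v ^+ 2 = 1 - u ^+ 2 by rewrite -uv1; ring.
have pi0 := @pi_gt0 R; have a0 := acos_ge0 u1; have api := acos_lepi u1.
have [v0|v0] := leP 0 v.
  exists (acos u); first by apply/andP; split; lra.
  by rewrite acosK ?sin_acos ?in_itv//= -v2 sqrtr_sqr ger0_norm.
exists (2 * pi - acos u); first by apply/andP; split; lra.
rewrite -cosN -[v]opprK -[sin _]opprK -sinN opprB.
rewrite mulr_natl cosB sinB cos2pi sin2pi !mulr1 !mulr0 addr0 subr0.
by rewrite acosK ?sin_acos ?in_itv//= -v2 sqrtr_sqr ltr0_norm ?opprK.
Qed.

(** Turning [(u, v)] back by the accumulated angle [th] gives the pair [(c, d)], whose derivative
    vanishes; applying the inverse rotation to its constant value recovers [(u, v)]. *)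
Lemma is_derive_rotation (u v w th : R -> R) (a b : R) : 
  th a = 0 -> v a = 0 -> 
  (forall t, a <= t < b -> [/\ is_derive t 1 u (w t * v t),
    is_derive t 1 v (- (w t * u t)) & is_derive t 1 th (w t)]) ->
  forall t, a <= t < b -> u t = u a * cos (th t) /\ v t = - (u a * sin (th t)).
Proof.
move=> tha va H t /andP[a_t tb].
pose c s := u s * cos (th s) + - (v s * sin (th s)).
pose d s := u s * sin (th s) + v s * cos (th s).
have dcos s : a <= s <= t -> [/\ is_derive s 1 u (w s * v s),
    is_derive s 1 v (- (w s * u s)),
    is_derive s 1 (fun s => cos (th s)) (- sin (th s) * w s) &
    is_derive s 1 (fun s => sin (th s)) (cos (th s) * w s)].
  move=> /andP[sa st]; have [|du dv dth] := H s.
    by rewrite sa (le_lt_trans st).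
  by split=> //; exact: is_derive_compf dth.
have cE : c a = c t.
  apply: is_derive0_eq a_t _ => s /dcos[du dv dc ds].
  apply: is_derive_eq (is_derive_addf (is_derive_mulf du dc)
    (is_derive_oppf (is_derive_mulf dv ds))) _.
  ring.
have dE : d a = d t.
  apply: is_derive0_eq a_t _ => s /dcos[du dv dc ds].
  apply: is_derive_eq (is_derive_addf (is_derive_mulf du ds) (is_derive_mulf dv dc)) _.
  ring.
move: cE dE; rewrite /c /d tha va cos0 sin0 !mulr1 mul0r !mulr0 addr0 oppr0 addr0.
have := cos2Dsin2 (th t); set C := cos _; set S := sin _ => CS uE uE'; split.
  have -> : u t = (C ^+ 2 + S ^+ 2) * u t by rewrite CS mul1r.
  transitivity ((u t * C - v t * S) * C + (u t * S + v t * C) * S); first by ring.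
  by rewrite -uE -uE' mul0r addr0.
have -> : v t = (C ^+ 2 + S ^+ 2) * v t by rewrite CS mul1r.
transitivity (- ((u t * C - v t * S) * S) + (u t * S + v t * C) * C); first by ring.
by rewrite -uE -uE' mul0r addr0.
Qed.

End Rotation.

(** * Periodic motion on the intersection of two circular cylinders *)

Section CircularLevels.
Context {R : realType}.
Variables (b A B : R).
Hypotheses (A0 : 0 < A) (B0 : 0 < B) (AB : `|A - B| < 2 * b) (bAB : 2 * b < A + B).

(** The intersection of the cylinders of radii [A] and [B] about the lines [z = - b] and [z = b] in
    the [(x, z)] and [(y, z)] coordinates. The section hypotheses are the strict triangle
    inequalities for the lengths [A], [B], [2 * b]. *)
Definition level_set (x y z : R) :=
  x ^+ 2 + (z + b) ^+ 2 = A ^+ 2 /\ y ^+ 2 + (z - b) ^+ 2 = B ^+ 2.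

Lemma level_set_range x y z : level_set x y z -> b - B <= z <= A - b.
Proof.
move=> [xz yz].
have h1 : `|z + b| <= `|A|.
  by rewrite -ler_sqr ?nnegrE// !real_normK ?num_real// -xz lerDr sqr_ge0.
have h2 : `|z - b| <= `|B|.
  by rewrite -ler_sqr ?nnegrE// !real_normK ?num_real// -yz lerDr sqr_ge0.
move: h1 h2; rewrite (gtr0_norm A0) (gtr0_norm B0) !ler_norml => /andP[? ?] /andP[? ?].
by apply/andP; split; lra.
Qed.

(** On the level set [x ^+ 2] factors as [(A - b - z) * (A + b + z)], and [y ^+ 2] as
    [(B - b + z) * (B + b - z)]. In each product the second factor stays positive on the range of
    [z], so its square root may be divided out. *)
Let cA (z : R) := Num.sqrt (A + b + z).
Let cB (z : R) := Num.sqrt (B + b - z).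
Let delta := A + B - 2 * b.

Let dAB : - (2 * b) < A - B < 2 * b. Proof. by rewrite -ltr_norml. Qed.

Let cA_arg z : b - B <= z <= A - b -> 0 < A + 2 * b - B <= A + b + z /\ A + b + z <= 2 * A.
Proof. by move: dAB => /andP[? ?] /andP[? ?]; split; [apply/andP; split|]; lra. Qed.

Let cB_arg z : b - B <= z <= A - b -> 0 < B + 2 * b - A <= B + b - z /\ B + b - z <= 2 * B.
Proof. by move: dAB => /andP[? ?] /andP[? ?]; split; [apply/andP; split|]; lra. Qed.

Let speed z := cA z * cB z / 2.

(** [A + b + z] lies between [A + 2 * b - B] and [2 * A], and [B + b - z] between [B + 2 * b - A]
    and [2 * B]. The products of the lower and of the upper bounds give [cmin] and [cmax]. *)
Let cmin := Num.sqrt ((2 * b) ^+ 2 - (A - B) ^+ 2) / 2.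
Let cmax := Num.sqrt (A * B).

Lemma speed_bounds z : b - B <= z <= A - b -> cmin <= speed z <= cmax.
Proof.
move=> zr; have [/andP[a0 a1] a2] := cA_arg zr; have [/andP[b0 b1] b2] := cB_arg zr.
rewrite /cmin /cmax /speed /cA /cB -sqrtrM; last lra.
apply/andP; split.
  rewrite ler_pM2r ?invr_gt0// ler_wsqrtr//.
  apply: (@le_trans _ _ ((A + 2 * b - B) * (B + 2 * b - A))); first lra.
  by apply: ler_pM => //; exact: ltW.
have -> : Num.sqrt (A * B) = Num.sqrt (2 * A * (2 * B)) / 2.
  rewrite (_ : 2 * A * (2 * B) = 2 ^+ 2 * (A * B)); last by ring.
  by rewrite [in RHS]sqrtrM ?sqr_ge0// sqrtr_sqr ger0_norm// mulrAC mulfV ?mul1r.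
rewrite ler_pM2r ?invr_gt0// ler_wsqrtr// ler_pM//; lra.
Qed.

Lemma cmin_gt0 : 0 < cmin.
Proof.
rewrite divr_gt0// sqrtr_gt0; move: dAB => /andP[? ?].
by rewrite subr_sqr mulr_gt0//; lra.
Qed.

Let cA_gt0 z : b - B <= z <= A - b -> 0 < cA z.
Proof. by move=> /cA_arg[/andP[? ?] _]; rewrite sqrtr_gt0; lra. Qed.

Let cB_gt0 z : b - B <= z <= A - b -> 0 < cB z.
Proof. by move=> /cB_arg[/andP[? ?] _]; rewrite sqrtr_gt0; lra. Qed.

Let cA_sqr z : b - B <= z <= A - b -> cA z ^+ 2 = A + b + z.
Proof. by move=> /cA_arg[/andP[? ?] _]; rewrite sqr_sqrtr; lra. Qed.

Let cB_sqr z : b - B <= z <= A - b -> cB z ^+ 2 = B + b - z.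
Proof. by move=> /cB_arg[/andP[? ?] _]; rewrite sqr_sqrtr; lra. Qed.

Lemma level_set_quotients x y z : level_set x y z ->
  (x / cA z) ^+ 2 = A - b - z /\ (y / cB z) ^+ 2 = B - b + z.
Proof.
move=> l; have zr := level_set_range l; case: l => xz yz.
have P0 := cA_gt0 zr; have Q0 := cB_gt0 zr.
have P2 := cA_sqr zr; have Q2 := cB_sqr zr.
split; rewrite expr_div_n ?P2 ?Q2.
  have -> : x ^+ 2 = (A - b - z) * (A + b + z) by rewrite -[x ^+ 2](addrK ((z + b) ^+ 2)) xz; ring.
  by rewrite mulfK// -P2 expf_neq0// gt_eqF.
have -> : y ^+ 2 = (B - b + z) * (B + b - z) by rewrite -[y ^+ 2](addrK ((z - b) ^+ 2)) yz; ring.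
by rewrite mulfK// -Q2 expf_neq0// gt_eqF.
Qed.

(* The level set is the curve [u^2 + v^2 = A + B - 2 b] in the coordinates
   [u = x / sqrt (A + b + z)], [v = y / sqrt (B + b - z)], along which the flow
   rotates clockwise with angular velocity [speed z]. *)
Lemma solution_quotients x y z t : solution b x y z ->
  level_set (x t) (y t) (z t) ->
  is_derive t 1 (fun s => x s / cA (z s)) (speed (z t) * (y t / cB (z t))) /\
  is_derive t 1 (fun s => y s / cB (z s)) (- (speed (z t) * (x t / cA (z t)))).
Proof.
move=> /(_ t)[dx dy dz] l; have zr := level_set_range l; case: l => xz yz.
have P0 := cA_gt0 zr; have Q0 := cB_gt0 zr.
have P2 := cA_sqr zr; have Q2 := cB_sqr zr.
have Pn0 : cA (z t) != 0 by rewrite gt_eqF.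
have Qn0 : cB (z t) != 0 by rewrite gt_eqF.
have dP : is_derive t 1 (fun s => cA (z s)) (- (x t * y t) / (2 * cA (z t))).
  apply: is_derive_sqrtf; first by move: P0; rewrite sqrtr_gt0.
  apply: is_derive_eq (is_derive_addf (is_derive_cstf (A + b) t) dz) _.
  by rewrite add0r.
have dQ : is_derive t 1 (fun s => cB (z s)) (x t * y t / (2 * cB (z t))).
  apply: is_derive_sqrtf; first by move: Q0; rewrite sqrtr_gt0.
  apply: is_derive_eq (is_derive_addf (is_derive_cstf (B + b) t) (is_derive_oppf dz)) _.
  by rewrite add0r opprK.
have xE : x t ^+ 2 = (A - b - z t) * (A + b + z t).
  by rewrite -[x t ^+ 2](addrK ((z t + b) ^+ 2)) xz; ring.
have yE : y t ^+ 2 = (B - b + z t) * (B + b - z t).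
  by rewrite -[y t ^+ 2](addrK ((z t - b) ^+ 2)) yz; ring.
split.
- apply: is_derive_eq (is_derive_mulf dx (@is_derive_invf _ (cA \o z) _ _ Pn0 dP)) _.
  rewrite /speed/=; move: P2 xE Pn0 Qn0; set P := cA _; set Q := cB _ => P2 xE Pn0 Qn0.
  (* Substituting the factored [x t ^+ 2] cancels [P ^+ 2]; the bracket becomes [(A + b + z t) / 2],
     that is [P ^+ 2 / 2]. *)
  transitivity (y t / P * ((z t + b) + x t ^+ 2 / (2 * P ^+ 2))); first by field.
  rewrite xE -P2.
  transitivity (y t / P * ((z t + b) + (A - b - z t) / 2)); first by congr (_ * (_ + _)); field.
  transitivity (y t / P * ((A + b + z t) / 2)); first by field.
  by rewrite -P2; field; rewrite Pn0 Qn0.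
- apply: is_derive_eq (is_derive_mulf dy (@is_derive_invf _ (cB \o z) _ _ Qn0 dQ)) _.
  rewrite /speed/=; move: Q2 yE Pn0 Qn0; set P := cA _; set Q := cB _ => Q2 yE Pn0 Qn0.
  transitivity (x t / Q * ((z t - b) - y t ^+ 2 / (2 * Q ^+ 2))); first by field.
  rewrite yE -Q2.
  transitivity (x t / Q * ((z t - b) - (B - b + z t) / 2)); first by congr (_ * (_ - _)); field.
  transitivity (- (x t / Q * ((B + b - z t) / 2))); first by field.
  by rewrite -Q2; field; rewrite Pn0 Qn0.
Qed.

(** The angle is an antiderivative of the angular velocity along the solution. The start [y 0 = 0],
    [0 < x 0] has angle [0] on the circle of radius [Num.sqrt delta]. *)
Lemma angle_function x y z tmax : solution b x y z ->
  (forall t, level_set (x t) (y t) (z t)) -> y 0 = 0 -> 0 < x 0 ->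
  exists th : R -> R, [/\ th 0 = 0,
    forall t : R, 0 <= t < tmax -> is_derive t 1 th (speed (z t)) &
    forall t : R, 0 <= t < tmax -> x t / cA (z t) = Num.sqrt delta * cos (th t) /\
      y t / cB (z t) = - (Num.sqrt delta * sin (th t))].
Proof.
move=> sol lev y0 x0.
have cspeed : continuous (fun t => speed (z t)).
  move=> t; have [dx dy dz] := sol t; have zr := level_set_range (lev t).
  have [/cA_gt0 + /cB_gt0] := (zr, zr); rewrite !sqrtr_gt0 => a0 b0.
  have dA := @is_derive_sqrtf R (fun t => A + b + z t) _ _ a0 (is_derive_addf (is_derive_cstf (A + b) t) dz).
  have dB := @is_derive_sqrtf R (fun t => B + b - z t) _ _ b0
    (is_derive_addf (is_derive_cstf (B + b) t) (is_derive_oppf dz)).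
  exact: is_derive_continuous (is_derive_mulf (is_derive_mulf dA dB) (is_derive_cstf _ t)).
have [th th0 dth] := continuous_antiderivative tmax cspeed.
exists th; split=> // t tr.
have r0 : x 0 / cA (z 0) = Num.sqrt delta.
  have [uE vE] := level_set_quotients (lev 0).
  have u0 : 0 <= x 0 / cA (z 0) by rewrite divr_ge0 ?sqrtr_ge0// ltW.
  rewrite -[LHS]ger0_norm// -sqrtr_sqr uE; congr Num.sqrt.
  by move: vE; rewrite y0 mul0r expr0n /delta/=; lra.
rewrite -r0.
apply: (@is_derive_rotation R (fun t => x t / cA (z t)) (fun t => y t / cB (z t))
  (fun t => speed (z t)) th 0 tmax) => //; first by rewrite y0 mul0r.
by move=> s sr; have [du dv] := solution_quotients sol (lev s); split=> //; exact: dth.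
Qed.

(** The square of the first quotient is [A - b - z], so it determines [z]; then the nonzero
    denominators are known, and the quotients give [x] and [y]. *)
Lemma level_set_quotients_inj x y z x' y' z' :
  level_set x y z -> level_set x' y' z' ->
  x / cA z = x' / cA z' -> y / cB z = y' / cB z' -> [/\ x = x', y = y' & z = z'].
Proof.
move=> l l' uE vE.
have zE : z = z'.
  have [e _] := level_set_quotients l; have [e' _] := level_set_quotients l'.
  have := e; rewrite uE e' => /eqP; rewrite -subr_eq0 => /eqP h.
  by apply/eqP; rewrite -subr_eq0 -h; apply/eqP; ring.
have zr := level_set_range l'.
split=> //.
- by move: uE; rewrite zE; apply: mulIf; rewrite invr_eq0 gt_eqF ?cA_gt0.
- by move: vE; rewrite zE; apply: mulIf; rewrite invr_eq0 gt_eqF ?cB_gt0.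
Qed.

(** Since the speed lies between [cmin] and [cmax], the angle increases from [0] and takes every
    value up to [2 * pi], so the whole circle is covered and the first return is a full turn.
    Integrating the speed bounds over that turn bounds the period. *)
Lemma center_orbit x y z : solution b x y z ->
  (forall t, level_set (x t) (y t) (z t)) -> y 0 = 0 -> 0 < x 0 ->
  exists T : R, [/\ 0 < T /\ [/\ x T = x 0, y T = y 0 & z T = z 0],
    forall t : R, 0 < t < T -> ~ (x t = x 0 /\ y t = y 0),
    forall x1 y1 z1, level_set x1 y1 z1 ->
      exists t, [/\ x t = x1, y t = y1 & z t = z1],
    Num.sqrt ((2 * b) ^+ 2 - (A - B) ^+ 2) / 2 * T <= 2 * pi &
    2 * pi <= Num.sqrt (A * B) * T].
Proof.
move=> sol lev y0 x0; have pi0 := @pi_gt0 R; have c0 := cmin_gt0.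
have dl0 : 0 < delta by rewrite /delta subr_gt0.
have sd0 : 0 < Num.sqrt delta by rewrite sqrtr_gt0.
(* With speed at least [cmin] the angle reaches [2 * pi] by time [t1]. The angle is taken up to
   [t1 + 1] because its properties hold on a half-open interval and are needed at [t1] itself. *)
pose t1 := 2 * pi / cmin; have t10 : 0 < t1 by rewrite divr_gt0// mulr_gt0.
have [th [th0 dth uv]] := angle_function (t1 + 1) sol lev y0 x0.
have spd t := speed_bounds (level_set_range (lev t)).
have dth' s : 0 <= s <= t1 -> is_derive s 1 th (speed (z s)).
  by move=> /andP[s0 s1]; apply: dth; rewrite s0/=; lra.
have uv' s : 0 <= s <= t1 -> x s / cA (z s) = Num.sqrt delta * cos (th s) /\
      y s / cB (z s) = - (Num.sqrt delta * sin (th s)).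
  by move=> /andP[s0 s1]; apply: uv; rewrite s0/=; lra.
have dlin (c s : R) : is_derive s 1 (fun t => - (c * t)) (- c).
  apply: is_derive_eq (is_derive_oppf (is_derive_mulf (is_derive_cstf c s) (is_derive_id s 1))) _.
  by rewrite mul0r add0r mulr1.
have th_min s t : 0 <= s -> s <= t -> t <= t1 -> cmin * (t - s) <= th t - th s.
  move=> s0 st tt.
  have K : th s + - (cmin * s) <= th t + - (cmin * t).
    apply: (@is_derive_ge_nondecreasing R (fun t => th t + - (cmin * t))
      (fun t => speed (z t) + - cmin)) => // r /andP[sr rt].
      apply: is_derive_addf (dth' r _) (dlin cmin r).
      by rewrite (le_trans s0)//= (le_trans rt).
    by rewrite subr_ge0; case/andP: (spd r).
  lra.
have th_max t : 0 <= t -> t <= t1 -> th t <= cmax * t.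
  move=> t0 tt.
  have K : th t + - (cmax * t) <= th 0 + - (cmax * 0).
    apply: (@is_derive_le_nonincreasing R (fun t => th t + - (cmax * t))
      (fun t => speed (z t) + - cmax)) => // r /andP[r0 rt].
      apply: is_derive_addf (dth' r _) (dlin cmax r).
      by rewrite r0 (le_trans rt).
    by rewrite subr_le0; case/andP: (spd r).
  by rewrite th0 mulr0 oppr0 addr0 subr_le0 in K.
have th1 : 2 * pi <= th t1.
  have := th_min 0 t1 (lexx _) (ltW t10) (lexx _).
  by rewrite th0 !subr0 /t1 mulrC divfK// gt_eqF.
have surj a : 0 <= a <= 2 * pi -> exists2 t, 0 <= t <= t1 & th t = a.
  move=> /andP[a0 a1].
  have [||t] := @IVT R th 0 t1 a (ltW t10); last by exists t.
    exact: is_derive_continuous_within dth'.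
  rewrite th0 ge_min a0/= le_max.
  by rewrite (le_trans a1 th1) orbT.
have [|T /andP[T0 TT] thT] := surj (2 * pi); first by rewrite lexx mulr_ge0// ltW.
have Tp : 0 < T.
  rewrite lt_neqAle T0 andbT; apply/eqP => TE; move: thT; rewrite -TE th0.
  by move=> /esym/eqP; rewrite gt_eqF// mulr_gt0.
have [u0 v0] : x 0 / cA (z 0) = Num.sqrt delta * cos (th 0) /\
      y 0 / cB (z 0) = - (Num.sqrt delta * sin (th 0)).
  by apply: uv'; rewrite lexx ltW.
exists T; split.
- split=> //; have [|uT vT] := uv' T; first by rewrite T0.
  apply: level_set_quotients_inj => //.
    by rewrite uT u0 th0 thT mulr_natl cos2pi cos0.
  by rewrite vT v0 th0 thT mulr_natl sin2pi sin0.
(* An earlier return would have angle strictly between [0] and [2 * pi] with zero sine, hence angle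
   [pi]; but there the cosine is [-1], against [0 < x t]. *)
- move=> t /andP[t0 tT] [xE yE].
  have tt1 : t <= t1 by rewrite (le_trans (ltW tT)).
  have [|uE vE] := uv' t; first by rewrite ltW.
  have thp : 0 < th t.
    have := th_min 0 t (lexx _) (ltW t0) tt1.
    by rewrite th0 !subr0; apply: lt_le_trans; rewrite mulr_gt0.
  have thl : th t < 2 * pi.
    have := th_min t T (ltW t0) (ltW tT) TT; rewrite thT -subr_gt0.
    by apply: lt_le_trans; rewrite mulr_gt0// subr_gt0.
  have sth : sin (th t) = 0.
    move: vE; rewrite yE y0 mul0r => /esym/eqP; rewrite oppr_eq0 mulf_eq0 gt_eqF//=.
    by move/eqP.
  have uE0 : 0 < cos (th t).
    rewrite -(pmulr_rgt0 _ sd0) -uE xE divr_gt0//.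
    exact/cA_gt0/level_set_range/lev.
  have [thpi|thpi|thpi] := ltgtP (th t) pi.
  + by have := @sin_gt0_pi R (th t); rewrite thp thpi sth ltxx => /(_ isT).
  + have := @sin_gt0_pi R (th t - pi).
    rewrite subr_gt0 thpi ltrBlDl -mulr2n -mulr_natl thl => /(_ isT).
    by rewrite sinB sth cospi sinpi mul0r mulr0 subrr ltxx.
  + by move: uE0; rewrite thpi cospi ltr0N1.
- move=> x1 y1 z1 l1; have [u1 v1] := level_set_quotients l1.
  (* The second coordinate changes sign because the motion is clockwise. *)
  have [|a ar [ca sa]] := @unit_circle_angle R (x1 / cA z1 / Num.sqrt delta)
    (- (y1 / cB z1 / Num.sqrt delta)).
    rewrite sqrrN 2![(_ / Num.sqrt delta) ^+ 2]expr_div_n u1 v1 sqr_sqrtr ?ltW//.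
    by move: dl0; rewrite /delta => dl0; field; rewrite gt_eqF.
  have [t tr thE] := surj a ar; exists t.
  have [uE vE] := uv' t tr.
  apply: level_set_quotients_inj => //.
    by rewrite uE thE -ca mulrC divfK// gt_eqF.
  by rewrite vE thE -sa mulrN opprK mulrC divfK// gt_eqF.
- by have := th_min 0 T (lexx _) T0 TT; rewrite thT th0 !subr0.
- by rewrite -thT; exact: th_max.
Qed.

End CircularLevels.

(** * The energy on the surface and its conservation *)

Section Energy.
Context {R : realType}.
Variables (beta M : R) (F : R -> 'rV[R]_3 -> 'rV[R]_3).
Hypotheses (beta0 : beta != 0) (flowF : is_flow (Xb beta) F).

Let m := pt 0 0 M.
Let S := Sigma beta (- (beta * M)).

Definition energy (p : 'rV[R]_3) : R :=
  (1 - M / beta) / 2 * cx p ^+ 2 + (1 + M / beta) / 2 * cy p ^+ 2 + (cz p - M) ^+ 2.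

(** Eliminating [cy p ^+ 2] by the equation of the surface shows that both conserved quantities
    equal the energy up to a constant. *)
Lemma Sigma_energy p : S p ->
  cx p ^+ 2 + (cz p + beta) ^+ 2 = energy p + (M + beta) ^+ 2 /\
  cy p ^+ 2 + (cz p - beta) ^+ 2 = energy p + (M - beta) ^+ 2.
Proof.
rewrite /S /Sigma /Gb /energy /= => Sp.
have yE : cy p ^+ 2 = cx p ^+ 2 + 4 * beta * (cz p - M) by lra.
by rewrite yE; split; field.
Qed.

(** The difference of the two equations is the equation of the surface. Thus the conserved
    quantities alone keep orbits on the surface and on their energy level. *)
Lemma energy_Sigma p e :
  cx p ^+ 2 + (cz p + beta) ^+ 2 = e + (M + beta) ^+ 2 ->
  cy p ^+ 2 + (cz p - beta) ^+ 2 = e + (M - beta) ^+ 2 -> S p /\ energy p = e.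
Proof.
move=> H1 H2; have Sp : S p by rewrite /S /Sigma /Gb /=; lra.
by split=> //; have [+ _] := Sigma_energy Sp; rewrite H1 => /addIr.
Qed.

Lemma flow_energy p t : S p -> S (F t p) /\ energy (F t p) = energy p.
Proof.
move=> Sp; have [xz yz] := Sigma_energy Sp; have sol := flow_solution p flowF.
have [F0 _] := flowF p.
apply: energy_Sigma; first by rewrite -xz (solution_integral t sol) F0.
by rewrite -yz (solution_integral' t sol) F0.
Qed.

(** * The elliptic case: stability and periodic orbits *)

Section Center.
Hypothesis Mbeta : `|M| < `|beta|.

(** A positive lower bound for the three coefficients of the energy. *)
Let kappa := (1 - `|M / beta|) / 2.

Let Mbeta1 : `|M / beta| < 1.
Proof. by rewrite normrM normfV ltr_pdivrMr ?normr_gt0// mul1r. Qed.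

Let kappa_gt0 : 0 < kappa.
Proof. by rewrite divr_gt0// subr_gt0. Qed.

Lemma energy_lower p :
  kappa * cx p ^+ 2 <= energy p /\ kappa * cy p ^+ 2 <= energy p /\
  kappa * (cz p - M) ^+ 2 <= energy p.
Proof.
rewrite /energy; set r := M / beta.
have h1 : r <= `|r| by exact: ler_norm.
have h2 : - r <= `|r| by rewrite -normrN ler_norm.
have h3 : `|r| < 1 by exact: Mbeta1.
have h4 : 0 <= `|r| by [].
have hx : 0 <= cx p ^+ 2 by exact: sqr_ge0.
have hy : 0 <= cy p ^+ 2 by exact: sqr_ge0.
have hz : 0 <= (cz p - M) ^+ 2 by exact: sqr_ge0.
rewrite /kappa -/r; move: hx hy hz; set X := cx p ^+ 2; set Y := cy p ^+ 2; set Z := (_ - M) ^+ 2.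
by move=> hx hy hz; split; [|split]; nra.
Qed.

Lemma energy_eq0 p : S p -> energy p = 0 -> p = m.
Proof.
move=> Sp e0; have [] := energy_lower p; rewrite e0 => hx [hy hz].
have sq0 (a : R) : kappa * a ^+ 2 <= 0 -> a = 0.
  rewrite pmulr_rle0// => a0; apply/eqP; rewrite -sqrf_eq0 eq_le a0.
  exact: sqr_ge0.
apply: rV3P; rewrite coord_pt; [exact: sq0|exact: sq0|].
by apply/eqP; rewrite -subr_eq0; apply/eqP/sq0.
Qed.

Lemma energy_ge0 p : 0 <= energy p.
Proof.
have [h _] := energy_lower p; apply: le_trans h.
by rewrite mulr_ge0 ?sqr_ge0// ltW.
Qed.

Lemma energy_small p r : 0 < r -> energy p < kappa * r ^+ 2 -> `|p - m| < r.
Proof.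
move=> r0 pr; have [hx [hy hz]] := energy_lower p.
have aux (a : R) : kappa * a ^+ 2 <= energy p -> `|a| < r.
  move=> h; have := le_lt_trans h pr; rewrite ltr_pM2l// -(@real_normK _ a) ?num_real//.
  by rewrite ltr_pXn2r// nnegrE ltW.
rewrite norm_rV3_lt !coordB !coord_pt !subr0 r0.
by apply/and4P; split; [|exact: aux..].
Qed.

Lemma energy_near p d : `|p - m| < d -> energy p <= 2 * d ^+ 2.
Proof.
rewrite norm_rV3_lt !coordB !coord_pt !subr0 => /and4P[d0 hx hy hz].
have aux (a : R) : `|a| < d -> 0 <= a ^+ 2 <= d ^+ 2.
  move=> /ltW h; rewrite sqr_ge0 -(@real_normK _ a) ?num_real//.
  by rewrite ler_pXn2r// nnegrE ltW.
move: hx hy hz => /aux/andP[x0 x1] /aux/andP[y0 y1] /aux/andP[z0 z1].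
rewrite /energy; move: Mbeta1; rewrite ltr_norml => /andP[h1 h2].
have hx : (1 - M / beta) / 2 * cx p ^+ 2 <= (1 - M / beta) / 2 * d ^+ 2.
  by rewrite ler_wpM2l//; lra.
have hy : (1 + M / beta) / 2 * cy p ^+ 2 <= (1 + M / beta) / 2 * d ^+ 2.
  by rewrite ler_wpM2l//; lra.
lra.
Qed.

Lemma center_stable : lyapunov_stable F S m.
Proof.
(* For this radius [d] the initial energy is at most [2 * d ^+ 2], that is
   [kappa * eps ^+ 2 * (kappa / 2)], and [kappa / 2 < 1]; energy below [kappa * eps ^+ 2] forces
   distance below [eps]. *)
move=> eps e0; exists (kappa * eps / 2); first by apply: divr_gt0 => //; exact: mulr_gt0.
move=> p Sp pd t _; apply: energy_small => //.
have [_ ->] := flow_energy t Sp; apply: (le_lt_trans (energy_near pd)).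
have -> : 2 * (kappa * eps / 2) ^+ 2 = kappa * eps ^+ 2 * (kappa / 2) by field.
rewrite gtr_pMr; last by apply: mulr_gt0 => //; exact: exprn_gt0.
have := normr_ge0 (M / beta); rewrite /kappa; lra.
Qed.

(** The radii of the two cylinders that cut out the energy level [e]. *)
Let amplA e := Num.sqrt (e + (M + beta) ^+ 2).
Let amplB e := Num.sqrt (e + (M - beta) ^+ 2).

(** The starting point of the orbit: the end [z = b - B] of the range, where [y] vanishes. *)
Lemma level_set_start (b A B : R) : 0 <= (A + B - 2 * b) * (A + 2 * b - B) ->
  level_set b A B (Num.sqrt ((A + B - 2 * b) * (A + 2 * b - B))) 0 (b - B).
Proof. by move=> h; split; rewrite ?sqr_sqrtr//; ring. Qed.

(** The squares of the radii differ by [4 * beta * M], which is less than [4 * beta ^+ 2] in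
    absolute value; this gives the first inequality. For the second, the radii strictly exceed the
    absolute values of [M + beta] and [M - beta], whose sum is at least twice that of [beta]. *)
Lemma amplitudes_triangle e : 0 < e -> [/\ 0 < amplA e, 0 < amplB e,
  `|amplA e - amplB e| < 2 * `|beta| & 2 * `|beta| < amplA e + amplB e].
Proof.
move=> e0; set A := amplA e; set B := amplB e.
have A2 : A ^+ 2 = e + (M + beta) ^+ 2 by rewrite sqr_sqrtr// addr_ge0 ?sqr_ge0// ltW.
have B2 : B ^+ 2 = e + (M - beta) ^+ 2 by rewrite sqr_sqrtr// addr_ge0 ?sqr_ge0// ltW.
have A0 : 0 < A by rewrite sqrtr_gt0 ltr_pwDl ?sqr_ge0.
have B0 : 0 < B by rewrite sqrtr_gt0 ltr_pwDl ?sqr_ge0.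
have hA : `|M + beta| < A.
  by rewrite -ltr_sqr ?nnegrE ?normr_ge0 ?(ltW A0)// real_normK ?num_real// A2 ltrDr.
have hB : `|M - beta| < B.
  by rewrite -ltr_sqr ?nnegrE ?normr_ge0 ?(ltW B0)// real_normK ?num_real// B2 ltrDr.
have bb : `|beta| ^+ 2 = beta ^+ 2 by rewrite real_normK ?num_real.
have bp : 0 < `|beta| by rewrite normr_gt0.
have [MB1 MB2] : - (`|beta| * `|beta|) < beta * M /\ beta * M < `|beta| * `|beta|.
  apply/andP; rewrite -ltr_norml normrM ltr_pM2l//.
split=> //.
- rewrite ltr_norml; apply/andP; split.
    suff : B < A + 2 * `|beta| by lra.
    rewrite -ltr_sqr ?nnegrE; [|lra|lra].
    rewrite B2 -subr_gt0.
    have -> : (A + 2 * `|beta|) ^+ 2 - (e + (M - beta) ^+ 2) =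
       A ^+ 2 + 4 * (A * `|beta|) + 4 * `|beta| ^+ 2 - (e + (M - beta) ^+ 2) by ring.
    rewrite A2 expr2; have := mulr_gt0 A0 bp; lra.
  suff : A < B + 2 * `|beta| by lra.
  rewrite -ltr_sqr ?nnegrE; [|lra|lra].
  rewrite A2 -subr_gt0.
  have -> : (B + 2 * `|beta|) ^+ 2 - (e + (M + beta) ^+ 2) =
     B ^+ 2 + 4 * (B * `|beta|) + 4 * `|beta| ^+ 2 - (e + (M + beta) ^+ 2) by ring.
  rewrite B2 expr2; have := mulr_gt0 B0 bp; lra.
- apply: (@le_lt_trans _ _ (`|M + beta| + `|M - beta|)); last lra.
  have -> : 2 * `|beta| = `|(M + beta) - (M - beta)|.
    by rewrite -{1}[2]ger0_norm// -normrM; congr `| _ |; ring.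
  exact: ler_normB.
Qed.

Lemma center_level e : 0 < e -> exists p T, [/\ S p /\ energy p = e,
  periodic_point F p T, (forall q, S q -> energy q = e -> flow_orbit F p q),
  Num.sqrt ((2 * beta) ^+ 2 - (amplA e - amplB e) ^+ 2) / 2 * T <= 2 * pi &
  2 * pi <= Num.sqrt (amplA e * amplB e) * T].
Proof.
move=> e0; have [] := amplitudes_triangle e0.
have A2 : amplA e ^+ 2 = e + (M + beta) ^+ 2 by rewrite sqr_sqrtr// addr_ge0 ?sqr_ge0// ltW.
have B2 : amplB e ^+ 2 = e + (M - beta) ^+ 2 by rewrite sqr_sqrtr// addr_ge0 ?sqr_ge0// ltW.
move: (amplA e) (amplB e) A2 B2 => A B A2 B2 A0 B0 AB bAB.
have SP q : S q -> energy q = e -> cx q ^+ 2 + (cz q + beta) ^+ 2 = A ^+ 2 /\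
    cy q ^+ 2 + (cz q - beta) ^+ 2 = B ^+ 2.
  by move=> /Sigma_energy[-> ->] ->.
have [bp|bn|] := ltgtP 0 beta; last by move=> /esym/eqP; rewrite (negbTE beta0).
- rewrite (gtr0_norm bp) in AB bAB; have := AB; rewrite ltr_norml => /andP[AB1 AB2].
  pose xx := (A + B - 2 * beta) * (A + 2 * beta - B).
  have xx0 : 0 < xx by rewrite mulr_gt0//; lra.
  pose p := pt (Num.sqrt xx) 0 (beta - B).
  have [l1 l2] := level_set_start (ltW xx0).
  have [F0 _] := flowF p.
  have [Sp ep] : S p /\ energy p = e.
    by apply: energy_Sigma; rewrite !coord_pt -?A2 -?B2.
  have lev t : level_set beta A B (cx (F t p)) (cy (F t p)) (cz (F t p)).
    by have [St et] := flow_energy t Sp; apply: SP => //; rewrite et.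
  have [||T [[T0 [Tx Ty Tz]] Tmin surj c1 c2]] :=
    center_orbit A0 B0 AB bAB (flow_solution p flowF) lev.
    by rewrite F0 coord_pt.
    by rewrite F0 coord_pt sqrtr_gt0.
  exists p, T; split=> //.
  + split=> //; first by apply: rV3P; rewrite ?Tx ?Ty ?Tz F0.
    move=> t t0 tT; apply/eqP => tp; apply: (Tmin t); first by rewrite t0.
    by rewrite tp F0.
  + move=> q Sq eq; have [xq yq] := SP q Sq eq.
    have [t [tx ty tz]] := surj (cx q) (cy q) (cz q) (conj xq yq).
    by exists t => //; apply: rV3P.
(* For negative [beta] the previous case applies to [- beta] with [x], [y] and the radii [A], [B]
   exchanged. *)
- rewrite (ltr0_norm bn) in AB bAB; have {}bn : 0 < - beta by rewrite oppr_gt0.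
  rewrite distrC in AB; rewrite addrC in bAB.
  have := AB; rewrite ltr_norml => /andP[AB1 AB2].
  pose yy := (B + A - 2 * - beta) * (B + 2 * - beta - A).
  have yy0 : 0 < yy by rewrite mulr_gt0//; lra.
  pose p := pt 0 (Num.sqrt yy) (- beta - A).
  have [l1 l2] := level_set_start (ltW yy0).
  have [F0 _] := flowF p.
  have [Sp ep] : S p /\ energy p = e.
    by apply: energy_Sigma; rewrite !coord_pt -?A2 -?B2// -l2 opprK.
  have lev t : level_set (- beta) B A (cy (F t p)) (cx (F t p)) (cz (F t p)).
    have [St et] := flow_energy t Sp; have [] := SP (F t p) St (etrans et ep).
    by rewrite /level_set opprK.
  have [||T [[T0 [Ty Tx Tz]] Tmin surj c1 c2]] :=
    center_orbit B0 A0 AB bAB (solution_swap (flow_solution p flowF)) lev.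
    by rewrite F0 coord_pt.
    by rewrite F0 coord_pt sqrtr_gt0.
  exists p, T; split=> //.
  + split=> //; first by apply: rV3P; rewrite ?Tx ?Ty ?Tz F0.
    move=> t t0 tT; apply/eqP => tp; apply: (Tmin t); first by rewrite t0.
    by rewrite tp F0.
  + move=> q Sq eq; have [xq yq] := SP q Sq eq.
    have [|t [tx ty tz]] := surj (cy q) (cx q) (cz q).
      by rewrite /level_set opprK.
    by exists t => //; apply: rV3P.
  + by move: c1; rewrite mulrN sqrrN -[B - A]opprB sqrrN.
  + by rewrite [A * B]mulrC.
Qed.

Lemma energy_continuous : continuous energy.
Proof.
move=> q.
have cX : {for q, continuous (@cx R)} by exact: coord_continuous.
have cY : {for q, continuous (@cy R)} by exact: coord_continuous.
have cZ : {for q, continuous (@cz R)} by exact: coord_continuous.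
have cZM := continuousB cZ (@cst_continuous _ _ M q).
have ax := continuousM (@cst_continuous _ _ ((1 - M / beta) / 2) q) (continuousM cX cX).
have ay := continuousM (@cst_continuous _ _ ((1 + M / beta) / 2) q) (continuousM cY cY).
exact: continuousD (continuousD ax ay) (continuousM cZM cZM).
Qed.

(* The paraboloid [Sigma] is star-shaped with respect to [m] in the coordinates
   [(x, y)], and [energy] is nondecreasing along the rays. *)
Lemma center_component e0 : 0 < e0 ->
  connected_component (S `\` [set q | S q /\ energy q = e0]) m =
  [set q | S q /\ energy q < e0].
Proof.
move=> e00; have Sm : S m by rewrite /S /Sigma /Gb /= !coord_pt; ring.
have em : energy m = 0.
  by rewrite /energy !coord_pt expr0n/= !mulr0 subrr expr0n !addr0.
apply/seteqP; split=> q /=.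
- move=> [B [Bm BS cB] Bq]; have [Sq /= neq] := BS q Bq; split=> //.
  rewrite ltNge; apply/negP => e0q.
  (* The energies on the connected set [B] form an interval containing [0]; if it went beyond [e0],
     it would contain the removed value [e0]. *)
  have /connected_intervalP itv : connected (energy @` B).
    apply: connected_continuous_connected cB _.
    exact/continuous_subspaceT/energy_continuous.
  have [|||p Bp pe] := itv 0 (energy q) _ _ e0.
  + by exists m.
  + by exists q.
  + by rewrite ltW.
  by have [Sp] := BS p Bp; apply.
move=> [Sq eq].
(* On the surface [z - M] is a quadratic form in [(x, y)], so scaling [x] and [y] by [s] scales it
   by [s ^+ 2]. The energy terms then carry factors [s ^+ 2] and [s ^+ 4], at most [1]. *)
pose path (s : R) := pt (s * cx q) (s * cy q) (M + s ^+ 2 * (cz q - M)).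
have cpath : continuous path.
  move=> s; apply/differentiable_continuous/derivable1_diffP.
  have ds := is_derive_id s (1 : R).
  have lin (c : R) := is_derive_mulf ds (is_derive_cstf c s).
  have quad := is_derive_addf (is_derive_cstf M s)
    (is_derive_mulf (is_derive_expf 1 ds) (is_derive_cstf (cz q - M) s)).
  apply: (@ex_derive _ _ _ _ _ _ (pt _ _ _)); apply/is_derive_rV3P.
  rewrite !coord_pt; split.
  - by rewrite [X in is_derive _ _ X](_ : _ = (fun s => s * cx q)) //; apply/funext => r; rewrite coord_pt.
  - by rewrite [X in is_derive _ _ X](_ : _ = (fun s => s * cy q)) //; apply/funext => r; rewrite coord_pt.
  - by rewrite [X in is_derive _ _ X](_ : _ = (fun s => M + s ^+ 2 * (cz q - M))) //; apply/funext => r; rewrite coord_pt.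
have Spath s : S (path s).
  move: Sq; rewrite /S /Sigma /Gb /= !coord_pt => Sq.
  have -> : 4^-1 * (- (s * cx q) ^+ 2 + (s * cy q) ^+ 2) - beta * (M + s ^+ 2 * (cz q - M)) =
    s ^+ 2 * (4^-1 * (- cx q ^+ 2 + cy q ^+ 2) - beta * cz q + beta * M) - beta * M by ring.
  by rewrite Sq addNr mulr0 sub0r.
have epath s : 0 <= s <= 1 -> energy (path s) <= energy q.
  move=> /andP[s0 s1]; rewrite /energy !coord_pt.
  have s21 : s ^+ 2 <= 1 by rewrite expr_le1.
  have s41 : s ^+ 2 ^+ 2 <= 1 by rewrite expr_le1 ?sqr_ge0.
  move: Mbeta1; rewrite ltr_norml => /andP[h1 h2].
  rewrite [M + _]addrC addrK !exprMn; apply: lerD; first apply: lerD.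
  - by rewrite mulrCA ler_piMl// mulr_ge0 ?sqr_ge0//; lra.
  - by rewrite mulrCA ler_piMl// mulr_ge0 ?sqr_ge0//; lra.
  - by rewrite ler_piMl ?sqr_ge0.
exists (path @` `[0, 1]); first split.
- exists 0; first by rewrite /= in_itv/= lexx ler01.
  by rewrite /path !mul0r expr0n/= mul0r addr0.
- move=> _ [s + <-]; rewrite /= in_itv/= => s01; split=> // -[_ /=] es.
  by have := epath s s01; rewrite es leNgt eq.
- apply: connected_continuous_connected (@segment_connected _ _ _) _.
  exact: continuous_subspaceT.
- exists 1; first by rewrite /= in_itv/= lexx ler01.
  by rewrite /path !mul1r expr1n mul1r addrC subrK -pt_eta.
Qed.

(** The radii tend to the absolute values of [M + beta] and [M - beta], with product
    [beta ^+ 2 - M ^+ 2] and squared difference [(2 * M) ^+ 2], so both period bounds have the same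
    limit. *)
Lemma period_bounds_cvg :
  2 * pi / Num.sqrt (amplA e * amplB e) @[e --> 0^'+] -->
    2 * pi / Num.sqrt (beta ^+ 2 - M ^+ 2) /\
  2 * pi / (Num.sqrt ((2 * beta) ^+ 2 - (amplA e - amplB e) ^+ 2) / 2) @[e --> 0^'+] -->
    2 * pi / Num.sqrt (beta ^+ 2 - M ^+ 2).
Proof.
have bM : 0 < beta ^+ 2 - M ^+ 2.
  rewrite subr_gt0 -(@real_normK _ beta) ?num_real// -(@real_normK _ M) ?num_real//.
  by rewrite ltr_pXn2r ?nnegrE.
have s0 : Num.sqrt (beta ^+ 2 - M ^+ 2) != 0 by rewrite gt_eqF// sqrtr_gt0.
have sqrt_cvg (f : R -> R) (l : R) : f e @[e --> 0^'+] --> l ->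
    Num.sqrt (f e) @[e --> 0^'+] --> Num.sqrt l.
  by move=> fl; exact: cvg_comp fl (@sqrt_continuous R l).
have cvg_ampl (c : R) : Num.sqrt (e + c ^+ 2) @[e --> 0^'+] --> `|c|.
  have -> : `|c| = Num.sqrt (0 + c ^+ 2) by rewrite add0r sqrtr_sqr.
  apply: (sqrt_cvg (fun e => e + c ^+ 2)); apply: cvg_at_right_filter.
  exact: is_derive_continuous (is_derive_addf (is_derive_id (0 : R) 1)
    (is_derive_cstf (c ^+ 2) 0)).
have cA := cvg_ampl (M + beta); have cB := cvg_ampl (M - beta).
have AB : `|M + beta| * `|M - beta| = beta ^+ 2 - M ^+ 2.
  by rewrite -normrM mulrC -subr_sqr distrC gtr0_norm.
split.
- apply: cvgM; first exact: cvg_cst.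
  by apply: cvgV => //; rewrite -AB; apply: (sqrt_cvg _ _ (cvgM cA cB)).
- have sE : Num.sqrt (beta ^+ 2 - M ^+ 2) =
     Num.sqrt ((2 * beta) ^+ 2 - (`|M + beta| - `|M - beta|) ^+ 2) / 2.
    have -> : (`|M + beta| - `|M - beta|) ^+ 2 = (2 * M) ^+ 2.
      rewrite sqrrB AB !real_normK ?num_real//; ring.
    have -> : (2 * beta) ^+ 2 - (2 * M) ^+ 2 = 2 ^+ 2 * (beta ^+ 2 - M ^+ 2) by ring.
    by rewrite [in RHS]sqrtrM ?sqr_ge0// sqrtr_sqr ger0_norm// mulrAC mulfV ?mul1r.
  rewrite sE; apply: cvgM; first exact: cvg_cst.
  apply: cvgV; first by rewrite -sE.
  apply: cvgM; last exact: cvg_cst.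
  have cAB : amplA e - amplB e @[e --> 0^'+] --> `|M + beta| - `|M - beta| by exact: cvgB.
  apply: (sqrt_cvg (fun e => (2 * beta) ^+ 2 - (amplA e - amplB e) ^+ 2)).
  by apply: cvgB; [exact: cvg_cst|exact: cvgM].
Qed.

End Center.

(** * The hyperbolic case: instability *)

Lemma saddle_unstable : `|beta| < `|M| -> unstable F S m.
Proof.
move=> bM stab.
(* With [c] half the gap, [z] within [c] of [M] gives [sg * (z + beta) >= c] and
   [sg * (z - beta) >= c]. *)
pose sg := Num.sg M; pose c := (`|M| - `|beta|) / 2.
have c0 : 0 < c by rewrite divr_gt0// subr_gt0.
have M0 : M != 0 by rewrite -normr_gt0 (le_lt_trans _ bM).
have sgM : sg * M = `|M| by rewrite normrEsg.
have sg2 : sg ^+ 2 = 1 by rewrite sqr_sg M0.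
have sg1 : `|sg| = 1 by rewrite normr_sg M0.
have [d d0 Hd] := stab c c0.
(* At height [M] the surface consists of the points with [x ^+ 2 = y ^+ 2]; the sign makes
   [sg * x * y] positive at the start. *)
pose p := pt (d / 2) (sg * (d / 2)) M.
have Sp : S p by rewrite /S /Sigma /Gb /= !coord_pt [(sg * _) ^+ 2]exprMn sg2; ring.
have pd : `|p - m| < d.
  rewrite norm_rV3_lt !coordB !coord_pt !subr0 d0 subrr normr0 d0 [`|sg * _|]normrM sg1 mul1r.
  by rewrite gtr0_norm ?divr_gt0//= andbT; apply/andP; split; lra.
have stay (t : R) : 0 <= t -> [/\ `|cx (F t p)| < c, `|cy (F t p)| < c & `|cz (F t p) - M| < c].
  move=> /(Hd p Sp pd); rewrite norm_rV3_lt !coordB !coord_pt !subr0.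
  by move=> /and4P[].
have sol := flow_solution p flowF.
pose w (t : R) := sg * (cx (F t p) * cy (F t p)).
pose dw (t : R) := sg * (cz (F t p) + beta) * cy (F t p) ^+ 2 + sg * (cz (F t p) - beta) * cx (F t p) ^+ 2.
have dwP (t : R) : is_derive t 1 w (dw t).
  have [dx dy dz] := sol t.
  apply: is_derive_eq (is_derive_mulf (is_derive_cstf sg t) (is_derive_mulf dx dy)) _.
  by rewrite /dw; ring.
have rate (t s : R) : 0 <= t -> `|s| <= `|beta| -> c <= sg * (cz (F t p) + s).
  move=> /stay[_ _ hz] hs.
  have -> : sg * (cz (F t p) + s) = `|M| + sg * (cz (F t p) - M) + sg * s.
    by rewrite -sgM; ring.
  have h1 : `|sg * (cz (F t p) - M)| < c by rewrite normrM sg1 mul1r.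
  have h2 : `|sg * s| <= `|beta| by rewrite normrM sg1 mul1r.
  move: h1 h2; rewrite ltr_norml ler_norml => /andP[h1 h1'] /andP[h2 h2'].
  by move: h1; rewrite /c; lra.
(* The derivative is at least [c * (x ^+ 2 + y ^+ 2)], and [2 * sg * x * y <= x ^+ 2 + y ^+ 2]. *)
have dw_ge (t : R) : 0 <= t -> 0 <= dw t /\ 2 * c * w t <= dw t.
  move=> t0; have h1 := rate t beta t0 (lexx _).
  have h2 := rate t (- beta) t0; rewrite normrN in h2; have {}h2 := h2 (lexx _).
  have le_dw : c * (cy (F t p) ^+ 2 + cx (F t p) ^+ 2) <= dw t.
    by rewrite mulrDr lerD// ler_wpM2r ?sqr_ge0.
  split; first by apply: le_trans le_dw; rewrite mulr_ge0 ?addr_ge0 ?sqr_ge0 ?ltW.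
  apply: le_trans le_dw; rewrite /w [2 * c]mulrC -mulrA ler_pM2l// -subr_ge0.
  have -> : cy (F t p) ^+ 2 + cx (F t p) ^+ 2 - 2 * (sg * (cx (F t p) * cy (F t p))) =
    (cy (F t p) - sg * cx (F t p)) ^+ 2 + (1 - sg ^+ 2) * cx (F t p) ^+ 2 by ring.
  by rewrite sg2 subrr mul0r addr0 sqr_ge0.
have w_ge (t : R) : 0 <= t -> w 0 <= w t.
  move=> t0; apply: (is_derive_ge_nondecreasing t0) => s /andP[s0 _] //.
  by have [] := dw_ge s s0.
have w0 : 0 < w 0.
  rewrite /w; have [-> _] := flowF p; rewrite !coord_pt.
  have -> : sg * (d / 2 * (sg * (d / 2))) = sg ^+ 2 * (d / 2) ^+ 2 by ring.
  by rewrite sg2 mul1r exprn_gt0// divr_gt0.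
have cw : 0 < 2 * c * w 0 by rewrite mulr_gt0// mulr_gt0.
(* By this time [w], growing at rate at least [2 * c * w 0], has gained [c ^+ 2], whereas staying
   within [c] of the equilibrium keeps [w] below [c ^+ 2]. *)
pose t := c ^+ 2 / (2 * c * w 0).
have t0 : 0 <= t by rewrite divr_ge0 ?sqr_ge0// ltW.
have w_lin : w 0 + - (2 * c * w 0 * 0) <= w t + - (2 * c * w 0 * t).
  apply: (@is_derive_ge_nondecreasing R (fun s => w s + - (2 * c * w 0 * s))
    (fun s => dw s + - (2 * c * w 0)) 0 t t0) => s /andP[s0 _].
    apply: is_derive_eq (is_derive_addf (dwP s) (is_derive_oppf
      (is_derive_mulf (is_derive_cstf _ s) (is_derive_id s 1)))) _.
    by rewrite mul0r add0r mulr1.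
  have [_ h] := dw_ge s s0; rewrite subr_ge0; apply: le_trans h.
  by rewrite ler_pM2l ?w_ge// mulr_gt0.
have tE : 2 * c * w 0 * t = c ^+ 2 by rewrite /t mulrC divfK ?gt_eqF.
rewrite mulr0 tE in w_lin.
have [hx hy _] := stay t t0.
have w_lt : w t < c ^+ 2.
  apply: le_lt_trans (ler_norm _) _; rewrite /w !normrM sg1 mul1r expr2.
  by apply: ltr_pM.
lra.
Qed.

End Energy.

(** * The derivative of the flow at the equilibrium *)

Section Linearization.
Context {R : realType}.

(** Fundamental solutions of [f'' = k f]: trigonometric, hyperbolic or affine according to the sign
    of [k]. All three occur, since [k] will be [M ^+ 2 - beta ^+ 2]. *)
Lemma hyperbolic_system (k : R) : exists c s : R -> R,
  [/\ c 0 = 1, s 0 = 0, forall t : R, is_derive t 1 c (k * s t) &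
      forall t : R, is_derive t 1 s (c t)].
Proof.
have dlin (r t : R) : is_derive t 1 (fun t => r * t) r.
  apply: is_derive_eq (is_derive_mulf (is_derive_cstf r t) (is_derive_id t 1)) _.
  by rewrite mul0r add0r mulr1.
have [k0|k0|k0] := ltgtP k 0.
- pose r := Num.sqrt (- k); have r0 : r != 0 by rewrite gt_eqF// sqrtr_gt0 oppr_gt0.
  have r2 : k = - r ^+ 2 by rewrite sqr_sqrtr ?opprK// oppr_ge0 ltW.
  exists (fun t => cos (r * t)), (fun t => sin (r * t) * r^-1).
  rewrite mulr0 cos0 sin0 mul0r; split=> // t.
    apply: is_derive_eq (is_derive_compf (is_derive_cos _) (dlin r t)) _.
    by rewrite r2; field.
  apply: is_derive_eq (is_derive_mulf (is_derive_compf (is_derive_sin _) (dlin r t))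
    (is_derive_cstf _ t)) _.
  by field.
- pose r := Num.sqrt k; have r0 : r != 0 by rewrite gt_eqF// sqrtr_gt0.
  have r2 : k = r ^+ 2 by rewrite sqr_sqrtr// ltW.
  exists (fun t => (expR (r * t) + expR (- r * t)) * 2^-1),
    (fun t => (expR (r * t) + - expR (- r * t)) * (2 * r)^-1).
  have de q t := is_derive_compf (is_derive_expR _) (dlin q t).
  rewrite !mulr0 expR0 subrr mul0r; split=> // [|t|t].
  + by rewrite -mulr2n -mulr_natl mulr1 mulfV.
  + apply: is_derive_eq (is_derive_mulf (is_derive_addf (de r t) (de (- r) t))
      (is_derive_cstf _ t)) _.
    by rewrite r2; field.
  + apply: is_derive_eq (is_derive_mulf (is_derive_addf (de r t)
      (is_derive_oppf (de (- r) t))) (is_derive_cstf _ t)) _.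
    by field.
- exists (fun=> 1), id; split=> // t.
    by rewrite k0 mul0r; exact: is_derive_cst.
  exact: is_derive_id.
Qed.

Variables (beta M : R) (F : R -> 'rV[R]_3 -> 'rV[R]_3).
Hypotheses (beta0 : beta != 0) (flowF : is_flow (Xb beta) F).

Let m := pt 0 0 M.

(** The derivative of [x ^+ 2 + y ^+ 2] is [4 * x * y * z], at most [2 * K] times the function
    itself in absolute value, and Gronwall applies. *)
Lemma solution_growth b (x y z : R -> R) K T : solution b x y z -> 0 <= K ->
  (forall t, `|z t| <= K) -> forall t, `|t| <= T ->
  x t ^+ 2 + y t ^+ 2 <= (x 0 ^+ 2 + y 0 ^+ 2) * expR (2 * K * T).
Proof.
move=> sol K0 zK t tT.
have := @gronwall R (fun t => x t ^+ 2 + y t ^+ 2) (fun t => 4 * (x t * y t * z t))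
  (2 * K) 0 T.
rewrite !addr0 => /(_ _ _ _ _ t tT); rewrite addr0; apply.
- by rewrite mulr_ge0.
- by rewrite addr_ge0 ?sqr_ge0.
- move=> s; have [dx dy dz] := sol s.
  apply: is_derive_eq (is_derive_addf (is_derive_expf 1 dx) (is_derive_expf 1 dy)) _.
  ring.
- move=> s _; rewrite addr0 !normrM ger0_norm//.
  have xy : 2 * (`|x s| * `|y s|) <= x s ^+ 2 + y s ^+ 2.
    rewrite -(@real_normK _ (x s)) ?num_real// -(@real_normK _ (y s)) ?num_real//.
    rewrite -subr_ge0.
    have -> : `|x s| ^+ 2 + `|y s| ^+ 2 - 2 * (`|x s| * `|y s|) = (`|x s| - `|y s|) ^+ 2 by ring.
    exact: sqr_ge0.
  have -> : 4 * (`|x s| * `|y s| * `|z s|) = 2 * `|z s| * (2 * (`|x s| * `|y s|)) by ring.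
  by apply: ler_pM => //; rewrite ?mulr_ge0// ler_pM2l.
Qed.

(** A chain of estimates uniform in [h]: [z] is bounded; by Gronwall [x ^+ 2 + y ^+ 2] is of order
    [h ^+ 2]; hence so is [z - M]; a second Gronwall argument then bounds the squared errors in [x]
    and [y] by order [h ^+ 4]. *)
Lemma flow_linear_approx (a d : R) (w1 w2 : R -> R) (T : R) :
  (forall t : R, is_derive t 1 w1 ((M + beta) * w2 t)) ->
  (forall t : R, is_derive t 1 w2 ((M - beta) * w1 t)) -> w1 0 = a -> w2 0 = d ->
  exists C, forall h t : R, `|h| <= 1 -> `|t| <= T -> let q := F t (pt (h * a) (h * d) M) in
    [/\ `|cx q - h * w1 t| <= C * h ^+ 2, `|cy q - h * w2 t| <= C * h ^+ 2 &
        `|cz q - M| <= C * h ^+ 2].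
Proof.
move=> dw1 dw2 w10 w20.
(* Conservation of [x ^+ 2 + (z + beta) ^+ 2] bounds [(z + beta) ^+ 2] by
   [r = a ^+ 2 + (M + beta) ^+ 2]; then [r <= (1 + r) ^+ 2] avoids a square root. *)
pose K := `|beta| + 1 + a ^+ 2 + (M + beta) ^+ 2.
have a2 := sqr_ge0 a; have d2 := sqr_ge0 d; have Mb2 := sqr_ge0 (M + beta).
have nb := normr_ge0 beta.
have K0 : 0 <= K by rewrite /K; lra.
pose N := a ^+ 2 + d ^+ 2; have N0 : 0 <= N by rewrite addr_ge0.
pose E1 := expR (2 * K * T); have E10 : 0 <= E1 by exact: expR_ge0.
pose D := N * (E1 + 1) / (4 * `|beta|).
have D0 : 0 <= D by rewrite divr_ge0 ?mulr_ge0 ?addr_ge0.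
pose K2 := 2 * `|M| + 1; have K20 : 1 <= K2 by rewrite lerDr mulr_ge0.
pose C1 := D ^+ 2 * (N * E1); have C10 : 0 <= C1 by rewrite mulr_ge0 ?sqr_ge0 ?mulr_ge0.
pose C2 := C1 * expR (K2 * T); have C20 : 0 <= C2 by rewrite mulr_ge0 ?expR_ge0.
exists (1 + C2 + D) => h t h1 tT /=; set p := pt _ _ _.
have h20 := sqr_ge0 h.
have h2 : h ^+ 2 <= 1 by rewrite -(@real_normK _ h) ?num_real// expr_le1.
have sol := flow_solution p flowF.
pose x t := cx (F t p); pose y t := cy (F t p); pose z t := cz (F t p).
have [F0 _] := flowF p.
have x0 : x 0 = h * a by rewrite /x F0 coord_pt.
have y0 : y 0 = h * d by rewrite /y F0 coord_pt.
have z0 : z 0 = M by rewrite /z F0 coord_pt.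
have zK s : `|z s| <= K.
  have H := solution_integral s sol; rewrite -/(x s) -/(z s) -/(x 0) -/(z 0) x0 z0 in H.
  have h3 : (z s + beta) ^+ 2 <= (1 + a ^+ 2 + (M + beta) ^+ 2) ^+ 2.
    apply: (@le_trans _ _ (a ^+ 2 + (M + beta) ^+ 2)).
      have := sqr_ge0 (x s); have : (h * a) ^+ 2 <= a ^+ 2 by rewrite exprMn ler_piMl.
      lra.
    have : 0 <= (a ^+ 2 + (M + beta) ^+ 2) ^+ 2 by exact: sqr_ge0.
    have -> : (1 + a ^+ 2 + (M + beta) ^+ 2) ^+ 2 =
      1 + 2 * (a ^+ 2 + (M + beta) ^+ 2) + (a ^+ 2 + (M + beta) ^+ 2) ^+ 2 by ring.
    lra.
  have h4 : `|z s + beta| <= 1 + a ^+ 2 + (M + beta) ^+ 2.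
    rewrite -(@ler_pXn2r _ 2)// ?nnegrE//; last lra.
    by rewrite real_normK ?num_real.
  rewrite -[z s](addrK beta); apply: le_trans (ler_normB _ _) _.
  by rewrite /K; lra.
have u_le s : `|s| <= T -> x s ^+ 2 + y s ^+ 2 <= h ^+ 2 * (N * E1).
  move=> sT; have := solution_growth sol K0 zK sT.
  by rewrite -/(x 0) -/(y 0) x0 y0 !exprMn -mulrDr -mulrA.
have zeta_le s : `|s| <= T -> `|z s - M| <= D * h ^+ 2.
  move=> sT; have := u_le s sT => us.
  have H1 := solution_integral s sol; have H2 := solution_integral' s sol.
  rewrite -/(x s) -/(y s) -/(z s) -/(x 0) -/(y 0) -/(z 0) x0 y0 z0 in H1 H2.
  (* In the difference of the two conserved quantities the squares of [z] cancel, so [z - M] is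
     expressed through quadratic terms. *)
  have zE : 4 * beta * (z s - M) = y s ^+ 2 - x s ^+ 2 - h ^+ 2 * (d ^+ 2 - a ^+ 2).
    have : (x s ^+ 2 + (z s + beta) ^+ 2) - (y s ^+ 2 + (z s - beta) ^+ 2) =
      (h * a) ^+ 2 + (M + beta) ^+ 2 - ((h * d) ^+ 2 + (M - beta) ^+ 2).
      by rewrite H1 H2.
    by lra.
  have : `|4 * beta * (z s - M)| <= h ^+ 2 * (N * (E1 + 1)).
    rewrite zE ler_norml; have := sqr_ge0 (x s); have := sqr_ge0 (y s).
    have ha : 0 <= h ^+ 2 * a ^+ 2 by rewrite mulr_ge0.
    have hd : 0 <= h ^+ 2 * d ^+ 2 by rewrite mulr_ge0.
    by move: us; rewrite /N => us xs ys; apply/andP; split; lra.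
  rewrite normrM (_ : `|4 * beta| = 4 * `|beta|); last by rewrite normrM ger0_norm.
  rewrite mulrC -ler_pdivlMr; last by rewrite mulr_gt0// normr_gt0.
  by move=> /le_trans; apply; rewrite /D; lra.
(* The errors satisfy [e1' = (M + beta) e2 + (z - M) y] and [e2' = (M - beta) e1 + (z - M) x]: the
   linearised system with a small forcing term. *)
pose e1 s := x s + - (h * w1 s); pose e2 s := y s + - (h * w2 s).
have err s : `|s| <= T -> e1 s ^+ 2 + e2 s ^+ 2 <= C2 * h ^+ 4.
  move=> sT.
  have := @gronwall R (fun s => e1 s ^+ 2 + e2 s ^+ 2)
    (fun s => 4 * M * (e1 s * e2 s) + 2 * (z s - M) * (e1 s * y s + e2 s * x s))
    K2 (C1 * h ^+ 4) T.
  have -> : e1 0 ^+ 2 + e2 0 ^+ 2 = 0.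
    by rewrite /e1 /e2 x0 y0 w10 w20 !subrr expr0n addr0.
  rewrite add0r => /(_ _ _ _ _ s sT) G.
  apply: le_trans (_ : _ <= C1 * h ^+ 4 * expR (K2 * T)) _; last by rewrite mulrAC.
  apply: le_trans (G _ _ _ _); first by rewrite lerDl mulr_ge0// -[4%N]/(2 * 2)%N exprM sqr_ge0.
  - lra.
  - by rewrite mulr_ge0// -[4%N]/(2 * 2)%N exprM sqr_ge0.
  - move=> r; have [dx dy dz] := sol r.
    have de1 := is_derive_addf dx (is_derive_oppf (is_derive_mulf (is_derive_cstf h r) (dw1 r))).
    have de2 := is_derive_addf dy (is_derive_oppf (is_derive_mulf (is_derive_cstf h r) (dw2 r))).
    apply: is_derive_eq (is_derive_addf (is_derive_expf 1 de1) (is_derive_expf 1 de2)) _.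
    rewrite /e1 /e2 -/(x r) -/(y r) -/(z r); ring.
  - move=> r rT; have zr := zeta_le r rT; have ur := u_le r rT.
    (* The forcing is of order [h ^+ 6]; [h ^+ 2 <= 1] lowers this to [h ^+ 4]. *)
    have zz : (z r - M) ^+ 2 * (x r ^+ 2 + y r ^+ 2) <= C1 * h ^+ 4.
      apply: (@le_trans _ _ ((D * h ^+ 2) ^+ 2 * (h ^+ 2 * (N * E1)))).
        apply: ler_pM => //; [exact: sqr_ge0|by rewrite addr_ge0 ?sqr_ge0|].
        rewrite -(@real_normK _ (z r - M)) ?num_real// ler_pXn2r// nnegrE.
        exact: mulr_ge0.
      have -> : (D * h ^+ 2) ^+ 2 * (h ^+ 2 * (N * E1)) = C1 * h ^+ 4 * h ^+ 2.
        by rewrite /C1; ring.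
      by rewrite ler_piMr// mulr_ge0// -[4%N]/(2 * 2)%N exprM sqr_ge0.
    have MM : - `|M| <= M <= `|M| by rewrite -ler_norml.
    case/andP: MM => M1 M2.
    set Z := z r - M; set X := x r; set Y := y r; set A := e1 r; set B := e2 r.
    have hA : 0 <= (A + Z * Y) ^+ 2 by exact: sqr_ge0.
    have hA' : 0 <= (A - Z * Y) ^+ 2 by exact: sqr_ge0.
    have hB : 0 <= (B + Z * X) ^+ 2 by exact: sqr_ge0.
    have hB' : 0 <= (B - Z * X) ^+ 2 by exact: sqr_ge0.
    have hM : `|4 * M * (A * B)| <= 2 * `|M| * (A ^+ 2 + B ^+ 2).
      have -> : `|4 * M * (A * B)| = 2 * `|M| * (2 * `|A * B|).
        by rewrite !normrM ger0_norm//; ring.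
      apply: ler_wpM2l; first by rewrite mulr_ge0.
      rewrite -[2 * _]ger0_norm ?mulr_ge0// normrM normr_id -normrM ler_norml.
      have := sqr_ge0 (A + B); have := sqr_ge0 (A - B).
      by move=> ? ?; apply/andP; split; lra.
    have hZ : `|2 * Z * (A * Y + B * X)| <= A ^+ 2 + B ^+ 2 + Z ^+ 2 * (X ^+ 2 + Y ^+ 2).
      by rewrite ler_norml; apply/andP; split; lra.
    apply: le_trans (ler_normD _ _) _; move: zz; rewrite -/Z -/X -/Y => zz.
    apply: le_trans (lerD hM hZ) _.
    have c0 : 0 <= C1 * h ^+ 4 by apply: le_trans zz; rewrite mulr_ge0 ?addr_ge0 ?sqr_ge0.
    have : C1 * h ^+ 4 <= K2 * (C1 * h ^+ 4) by rewrite ler_peMl.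
    by rewrite mulrDr /K2; lra.
have root (e : R) : e ^+ 2 <= C2 * h ^+ 4 -> `|e| <= (1 + C2 + D) * h ^+ 2.
  move=> he; apply: (@le_trans _ _ ((1 + C2) * h ^+ 2)); last by rewrite ler_wpM2r// lerDl.
  have c2 : 0 <= (1 + C2) * h ^+ 2 by apply: mulr_ge0 => //; exact: addr_ge0.
  rewrite -(@ler_pXn2r _ 2)// ?nnegrE//.
  rewrite real_normK ?num_real// (le_trans he)// exprMn -exprM ler_wpM2r//.
    by rewrite -[4%N]/(2 * 2)%N exprM sqr_ge0.
  by have := sqr_ge0 C2; rewrite sqrrD expr1n mul1r; lra.
have et := err t tT; have q1 := sqr_ge0 (e1 t); have q2 := sqr_ge0 (e2 t).
split.
- by apply: root; rewrite -/(x t) -/(e1 t); lra.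
- by apply: root; rewrite -/(y t) -/(e2 t); lra.
- apply: le_trans (zeta_le t tT) _; rewrite ler_wpM2r// lerDr; lra.
Qed.

Lemma flow_derive (a d : R) (w1 w2 : R -> R) (t : R) :
  (forall t : R, is_derive t 1 w1 ((M + beta) * w2 t)) ->
  (forall t : R, is_derive t 1 w2 ((M - beta) * w1 t)) -> w1 0 = a -> w2 0 = d ->
  is_derive m (pt a d 0) (F t) (pt (w1 t) (w2 t) 0).
Proof.
move=> dw1 dw2 w10 w20.
have [C HC] := @flow_linear_approx a d w1 w2 `|t| dw1 dw2 w10 w20.
have mE (h : R) : h *: pt a d 0 + m = pt (h * a) (h * d) M.
  by apply: rV3P; rewrite coord_lin !coord_pt ?addr0// mulr0 add0r.
(* The estimate at [h = 0] shows that the flow fixes [m]. *)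
have Fm : F t m = m.
  have [||] := HC 0 t; rewrite ?normr0// !mul0r expr0n/= mulr0 !normr_le0 !subr0.
  move=> /eqP x0 /eqP y0; rewrite subr_eq0 => /eqP z0.
  by apply: rV3P; rewrite coord_pt.
apply/is_derive_rV3P; rewrite !coord_pt; split; apply: (@is_derive_quadratic _ _ _ _ _ _ C);
  move=> h h1; rewrite mE Fm !coord_pt ?subr0 ?mulr0 ?subr0;
  by have [] := HC h t h1 (lexx _).
Qed.

Lemma linearizationE (v : 'rV[R]_3) : cz v = 0 ->
  linearization F m v = pt ((M + beta) * cy v) ((M - beta) * cx v) 0.
Proof.
move=> v0; have [c [s [c0 s0 dc ds]]] := hyperbolic_system (M ^+ 2 - beta ^+ 2).
rewrite /linearization [in LHS](pt_eta v) v0.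
move: (cx v) (cy v) => a d.
(* The solution of the linearised system starting at [(a, d)]; [c] and [s] fit because
   [(M + beta) * (M - beta)] is their constant [k]. *)
pose w1 (t : R) := a * c t + (M + beta) * d * s t.
pose w2 (t : R) := d * c t + (M - beta) * a * s t.
have dw1 (t : R) : is_derive t 1 w1 ((M + beta) * w2 t).
  apply: is_derive_eq (is_derive_addf (is_derive_mulf (is_derive_cstf a t) (dc t))
    (is_derive_mulf (is_derive_cstf ((M + beta) * d) t) (ds t))) _.
  rewrite /w2; ring.
have dw2 (t : R) : is_derive t 1 w2 ((M - beta) * w1 t).
  apply: is_derive_eq (is_derive_addf (is_derive_mulf (is_derive_cstf d t) (dc t))
    (is_derive_mulf (is_derive_cstf ((M - beta) * a) t) (ds t))) _.
  rewrite /w1; ring.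
have w10 : w1 0 = a by rewrite /w1 c0 s0; ring.
have w20 : w2 0 = d by rewrite /w2 c0 s0; ring.
have -> : (fun t => 'D_(pt a d 0) (F t) m) = (fun t => pt (w1 t) (w2 t) 0).
  by apply/funext => t; apply: derive_val; exact: flow_derive.
apply: derive_val; apply/is_derive_rV3P; rewrite !coord_pt; split.
- by under eq_fun do rewrite coord_pt; rewrite -[in X in is_derive _ _ _ X]w20.
- by under eq_fun do rewrite coord_pt; rewrite -[in X in is_derive _ _ _ X]w10.
- by under eq_fun do rewrite coord_pt; exact: is_derive_cst.
Qed.

(** At [m] the terms of [Gb] in [x] and [y] are purely quadratic, so its derivative is
    [- beta * cz v]. *)
Lemma tangent_spaceE : tangent_space (Gb beta) m = [set v | cz v = 0].
Proof.
have dG v : 'D_v (Gb beta) m = - beta * cz v.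
  apply: derive_val; apply: (@is_derive_quadratic _ _ _ _ _ _
    `|4^-1 * (- cx v ^+ 2 + cy v ^+ 2)|) => h _.
  rewrite /Gb !coord_lin !coord_pt -[h ^+ 2]ger0_norm ?sqr_ge0// -normrM.
  by rewrite le_eqVlt; apply/orP; left; apply/eqP; congr `| _ |; ring.
apply/seteqP; split=> v /=; rewrite /tangent_space /= dG.
  by move=> /eqP; rewrite mulf_eq0 oppr_eq0 (negbTE beta0) => /eqP.
by move=> ->; rewrite mulr0.
Qed.

End Linearization.

(** * Characteristic polynomials of two-by-two matrices *)

Section CharPoly.
Context {R : realType}.

Lemma char_poly2 (A : 'M[R]_2) :
  char_poly A = 'X^2 - (\tr A)%:P * 'X + (\det A)%:P.
Proof.
apply/polyP => -[|[|[|i]]]; rewrite coefD coefB coefCM coefXn coefX coefC/=.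
- by rewrite char_poly_det sqrrN expr1n mul1r mulr0 subr0 add0r.
- by rewrite mulr1 addr0 sub0r; exact: (char_poly_trace A).
- rewrite mulr0 subr0 addr0; have /monicP := char_poly_monic A.
  by rewrite /lead_coef size_char_poly.
- by rewrite nth_default ?size_char_poly// mulr0 subr0 addr0.
Qed.

Lemma det2 (A : 'M[R]_2) :
  \det A = A ord0 ord0 * A ord_max ord_max - A ord0 ord_max * A ord_max ord0.
Proof.
rewrite (expand_det_row _ ord0) !big_ord_recl big_ord0 addr0 /cofactor !det_mx11 !mxE /=.
have -> : lift ord0 ord0 = ord_max :> 'I_2 by apply: val_inj.
have -> : lift ord_max ord0 = ord0 :> 'I_2 by apply: val_inj.
by rewrite addn0 expr0 mul1r add0n expr1 mulN1r mulrN.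
Qed.

End CharPoly.

(** * Matrices of an antidiagonal map in an arbitrary basis of the plane *)

Section PlaneBasis.
Context {R : realType}.

Lemma ord2_ind (P : 'I_2 -> Prop) : P ord0 -> P ord_max -> forall i, P i.
Proof.
move=> P0 P1 [[|[|//]] i2].
- by rewrite (_ : Ordinal _ = ord0) //; apply: val_inj.
- by rewrite (_ : Ordinal _ = ord_max) //; apply: val_inj.
Qed.

Lemma sum2 (V : nmodType) (f : 'I_2 -> V) : \sum_(i < 2) f i = f ord0 + f ord_max.
Proof. by rewrite !big_ord_recl big_ord0 addr0; congr (_ + f _); apply: val_inj. Qed.

(** The matrix [E] of the basis in standard coordinates has inverse [B], built by expressing the
    unit vectors in the basis. The representing matrix [B *m L0 *m E] is similar to [L0], so it has
    trace [0] and determinant [- (a * b)]. *)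
Lemma represents_antidiagonal (L : 'rV[R]_3 -> 'rV[R]_3) (a b : R)
    (e : 'I_2 -> 'rV[R]_3) :
  is_basis2 [set v | cz v = 0] e ->
  (forall v, cz v = 0 -> L v = pt (a * cy v) (b * cx v) 0) ->
  exists A : 'M[R]_2, represents L e A /\ char_poly A = 'X^2 - (a * b)%:P.
Proof.
move=> [ez _ span] LE.
pose E : 'M[R]_2 := \matrix_(i, j) (if i == ord0 then cx (e j) else cy (e j)).
pose L0 : 'M[R]_2 := \matrix_(i, j) (if i == j then 0 else if i == ord0 then a else b).
have comb (c : 'I_2 -> R) : \sum_(j < 2) c j *: e j =
    pt (c ord0 * cx (e ord0) + c ord_max * cx (e ord_max))
       (c ord0 * cy (e ord0) + c ord_max * cy (e ord_max)) 0.
  have e0 : e ord0 = pt (cx (e ord0)) (cy (e ord0)) 0 by rewrite [LHS]pt_eta (ez ord0).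
  have e1 : e ord_max = pt (cx (e ord_max)) (cy (e ord_max)) 0.
    by rewrite [LHS]pt_eta (ez ord_max).
  rewrite sum2; apply: rV3P; rewrite coord_lin -[c ord_max *: _]addr0 coord_lin !coord_pt.
  - by rewrite /cx mxE addr0.
  - by rewrite /cy mxE addr0.
  - by rewrite !ez !mulr0 !add0r /cz mxE.
have [c cE] := span (pt 1 0 0) (cz_pt _ _ _).
have [d dE] := span (pt 0 1 0) (cz_pt _ _ _).
pose B : 'M[R]_2 := \matrix_(i, j) (if j == ord0 then c i else d i).
rewrite comb in cE; rewrite comb in dE.
have EB : E *m B = 1%:M.
  apply/matrixP; apply: ord2_ind; apply: ord2_ind; rewrite !mxE sum2 !mxE/=.
  - by have := congr1 (@cx R) cE; rewrite !coord_pt mulrC [X in _ + X]mulrC => <-.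
  - by have := congr1 (@cx R) dE; rewrite !coord_pt mulrC [X in _ + X]mulrC => <-.
  - by have := congr1 (@cy R) cE; rewrite !coord_pt mulrC [X in _ + X]mulrC => <-.
  - by have := congr1 (@cy R) dE; rewrite !coord_pt mulrC [X in _ + X]mulrC => <-.
have EA : E *m (B *m L0 *m E) = L0 *m E by rewrite !mulmxA EB mul1mx.
exists (B *m L0 *m E); split.
  move=> j; rewrite LE ?ez// comb.
  have h0 := congr1 (fun A : 'M[R]_2 => A ord0 j) EA.
  have h1 := congr1 (fun A : 'M[R]_2 => A ord_max j) EA.
  move: h0 h1; move: (B *m L0 *m E) => A.
  rewrite !mxE !sum2 !mxE/= !mul0r add0r addr0 => h0 h1.
  by congr pt; rewrite -?h0 -?h1 mulrC [X in _ + X]mulrC.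
have trA : \tr (B *m L0 *m E) = 0.
  by rewrite -mulmxA mxtrace_mulC -mulmxA EB mulmx1 /mxtrace sum2 !mxE/= addr0.
have detA : \det (B *m L0 *m E) = - (a * b).
  rewrite !det_mulmx mulrAC -det_mulmx (mulmx1C EB) det1 mul1r det2 !mxE/=.
  by rewrite mul0r sub0r.
by rewrite char_poly2 trA detA mul0r subr0 polyCN.
Qed.

End PlaneBasis.

(** * Assembly of the four claims *)

Theorem theorem7p3 (R : realType) (beta M : R) (F : R -> 'rV[R]_3 -> 'rV[R]_3) :
  beta != 0 ->
  is_flow (Xb beta) F ->
  let m := pt 0 0 M in
  let S := Sigma beta (- (beta * M)) in
  (* (a) *)
  (forall e : 'I_2 -> 'rV[R]_3, is_basis2 (tangent_space (Gb beta) m) e ->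
     exists A : 'M[R]_2, represents (linearization F m) e A /\
       char_poly A = 'X^2 + (beta ^+ 2 - M ^+ 2)%:P) /\
  (* (b) *)
  (`|beta| < `|M| -> unstable F S m) /\
  (* (c) *)
  (`|beta| > `|M| -> lyapunov_stable F S m) /\
  (* (d) *)
  (`|beta| > `|M| ->
     exists eps0 : R, 0 < eps0 /\
     exists (p : R -> 'rV[R]_3) (T : R -> R),
       let gamma := fun eps : R => flow_orbit F (p eps) in
       [/\ forall eps, 0 < eps <= eps0 -> gamma eps `<=` S /\ periodic_point F (p eps) (T eps),
           (forall eta : R, 0 < eta -> exists2 e1 : R, 0 < e1 &
              forall eps, 0 < eps <= e1 -> eps <= eps0 -> gamma eps `<=` ball m eta),
           T eps @[eps --> 0^'+] --> 2 * pi / Num.sqrt (beta ^+ 2 - M ^+ 2) &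
           [set m] `|` \bigcup_(eps in [set e | 0 < e < eps0]) gamma eps
             = connected_component (S `\` gamma eps0) m]).
Proof.
move=> beta0 flowF m S; split; [|split; [|split]].
- move=> e; rewrite (tangent_spaceE M beta0) => basis.
  have [A [repA charA]] := represents_antidiagonal basis (linearizationE M beta0 flowF).
  exists A; split=> //; rewrite charA -polyCN; congr (_ + _%:P); ring.
- exact: saddle_unstable.
- exact: center_stable.
move=> Mbeta.
(* The guard [0 < e] makes the statement total, as the choice of a family requires; [(m, 0)] is a
   dummy value elsewhere. *)
have orbits (e : R) : exists pT : 'rV[R]_3 * R, 0 < e ->
    [/\ S pT.1 /\ energy beta M pT.1 = e, periodic_point F pT.1 pT.2,
      (forall q, S q -> energy beta M q = e -> flow_orbit F pT.1 q) &
      2 * pi / Num.sqrt (Num.sqrt (e + (M + beta) ^+ 2) * Num.sqrt (e + (M - beta) ^+ 2))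
      <= pT.2 <=
      2 * pi / (Num.sqrt ((2 * beta) ^+ 2 - (Num.sqrt (e + (M + beta) ^+ 2) -
        Num.sqrt (e + (M - beta) ^+ 2)) ^+ 2) / 2)].
  have [e0|e0] := ltP 0 e; last by exists (m, 0).
  have [p [T [pe pT lev c1 c2]]] := center_level beta0 flowF Mbeta e0.
  exists (p, T) => _; split=> //=; have [A0 B0 AB bAB] := amplitudes_triangle beta0 Mbeta e0.
  move: AB; rewrite ltr_norml => /andP[AB1 AB2].
  rewrite ler_pdivrMr ?sqrtr_gt0 ?mulr_gt0// ler_pdivlMr.
    by rewrite [T * _]mulrC c2 [T * _]mulrC c1.
  rewrite divr_gt0// sqrtr_gt0.
  have -> : (2 * beta) ^+ 2 = (2 * `|beta|) ^+ 2.
    by rewrite !exprMn real_normK ?num_real.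
  by rewrite subr_sqr mulr_gt0//; lra.
have [pT HpT] := choice orbits.
have gammaE e : 0 < e ->
    flow_orbit F (pT e).1 = [set q | S q /\ energy beta M q = e].
  move=> /HpT[[Sp ep] _ lev _]; apply/seteqP; split=> q /=.
    by move=> [t _ <-]; have := flow_energy beta0 flowF t Sp; rewrite ep.
  by move=> [Sq eq]; exact: lev.
(* The family is indexed by energy; every positive energy carries one orbit, and [1] is an arbitrary
   cutoff. *)
exists 1; split=> //; exists (fun e => (pT e).1), (fun e => (pT e).2) => /=; split.
- move=> e /andP[e0 _]; have [_ per _ _] := HpT e e0; split=> //.
  by rewrite gammaE// => q [].
- move=> eta eta0; pose kappa := (1 - `|M / beta|) / 2.
  have kappa0 : 0 < kappa.
    by rewrite divr_gt0// subr_gt0 normrM normfV ltr_pdivrMr ?normr_gt0// mul1r.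
  have ke : 0 < kappa * eta ^+ 2 by apply: mulr_gt0 => //; exact: exprn_gt0.
  (* Halving makes the energy strictly less than [kappa * eta ^+ 2] even at the endpoint. *)
  exists (kappa * eta ^+ 2 / 2); first by rewrite divr_gt0.
  move=> e /andP[e0 ee] _; rewrite gammaE// => q [Sq eq].
  rewrite mx_norm_ball /ball_ /= distrC; apply: (energy_small beta0 Mbeta) => //.
  by rewrite -/kappa eq (le_lt_trans ee)// ltr_pdivrMr// ltr_pMr// ltr1n.
- have [lim1 lim2] := period_bounds_cvg Mbeta.
  apply: squeeze_cvgr lim1 lim2.
  near=> e; have e0 : 0 < e by near: e; exact: nbhs_right_gt.
  by have [] := HpT e e0.
- rewrite gammaE// (center_component beta0 Mbeta)//; apply/seteqP; split=> q /=.
    move=> [->|[e /andP[e0 e1]]].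
      rewrite /S /Sigma /Gb /energy /= !coord_pt; split; first ring.
      by rewrite subrr expr0n/= !mulr0 !addr0.
    by rewrite gammaE// => -[Sq ->].
  (* A point of energy [0] is [m]; any other point of the component lies on the orbit indexed by its
     own energy. *)
  move=> [Sq eq1]; have := energy_ge0 beta0 Mbeta q; rewrite le_eqVlt => /orP[/eqP e0|e0].
    by left; exact: (energy_eq0 beta0 Mbeta).
  by right; exists (energy beta M q); [rewrite /= e0|rewrite gammaE].
Unshelve. all: by end_near. Qed.
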